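(* Let $\mu>-1$ and $a>0$. Then the function $$x\mapsto \rho_{\mu,a}(x)=\frac{1}{2^{\mu}\Gamma(\mu+1)}\,\frac{(a\sqrt{x})^{\mu}}{I_{\mu}(a\sqrt{x})},\qquad x>0,$$ is the Laplace transform of a generalized gamma convolution, and therefore it is also the Laplace transform of a self-decomposable distribution.
   Context: $I_\mu$ is the modified Bessel function of the first kind of order $\mu$, and $\Gamma$ is the Euler gamma function. The Laplace transform of a probability distribution $\nu$ on $[0,\infty)$ is $x\mapsto\int_0^\infty e^{-xt}d\nu(t)$. A probability distribution on $[0,\infty)$ is a generalized gamma convolution if its Laplace transform has the form $L(s)=\exp\left(-\alpha s+\int_0^\infty \ln\left(\frac{t}{s+t}\right)dm(t)\right)$, $s\ge 0$, with $\alpha\ge0$ and $m$ a non-negative measure. A random variable $X$ (or its law) is self-decomposable if for every $c\in(0,1)$ there is a random variable $X_c$ independent of $X$ such that $X$ and $X_c+cX$ are equal in law. *)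

(* Defs.v *)
From HB Require Import structures.
From mathcomp Require Import all_boot all_order all_algebra.
From mathcomp Require Import all_classical all_reals all_analysis.

Set Implicit Arguments.
Unset Strict Implicit.
Unset Printing Implicit Defensive.

Import Order.TTheory GRing.Theory Num.Theory.
Import numFieldNormedType.Exports.

Local Open Scope classical_set_scope.
Local Open Scope ring_scope.

(* Meaningful for 0 < z only (otherwise the integral diverges and [Rintegral]
   returns a junk value). *)
Definition Gamma (R : realType) (z : R) : R :=
  (\int[lebesgue_measure]_(t in `]0, +oo[) (t `^ (z - 1) * expR (- t)))%R.

(* I_mu(x) = sum_k (x/2)^(2k+mu) / (k! Gamma(mu+k+1)), for -1 < mu (so that
   every argument of Gamma is positive) and 0 < x. *)
Definition besselI (R : realType) (mu x : R) : R :=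
  limn (series (fun k : nat =>
    (x / 2) `^ ((2 * k)%:R + mu) / (k`!%:R * Gamma (mu + k%:R + 1)))).

Definition rho (R : realType) (mu a x : R) : R :=
  (2 `^ mu * Gamma (mu + 1))^-1
  * ((a * Num.sqrt x) `^ mu / besselI mu (a * Num.sqrt x)).

(* Distributions on [0, +oo[ are encoded as probability measures on the real
   line that give full mass to [0, +oo[. *)
Definition on_nonneg (R : realType) (nu : probability (measurableTypeR R) R) :=
  nu `[0, +oo[%classic = 1%E.

Definition laplace (R : realType) (nu : probability (measurableTypeR R) R)
    (x : R) : R :=
  (\int[nu]_(t in `[0, +oo[) expR (- (x * t)))%R.

(* The exponent is an extended real and [expeR -oo = 0]; since the Laplace
   transform is positive, the equation forces the integral to be finite. Only
   the restriction of [m] to ]0, +oo[ matters. *)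
Definition GGC (R : realType) (nu : probability (measurableTypeR R) R) : Prop :=
  on_nonneg nu /\
  exists (alpha : R) (m : {measure set (measurableTypeR R) -> \bar R}),
    0 <= alpha /\
    forall s : R, 0 <= s ->
      (laplace nu s)%:E =
      expeR ((- (alpha * s))%:E
             + \int[m]_(t in `]0%R, +oo[) (ln (t / (s + t)))%:E)%E.

Definition independent_RV d (T : measurableType d) (R : realType)
    (P : probability T R) (X Y : {mfun T >-> measurableTypeR R}) : Prop :=
  forall A B : set (measurableTypeR R), measurable A -> measurable B ->
    P (X @^-1` A `&` Y @^-1` B) = (P (X @^-1` A) * P (Y @^-1` B))%E.

Definition has_law d (T : measurableType d) (R : realType)
    (P : probability T R) (X : T -> R)
    (nu : probability (measurableTypeR R) R) : Prop :=
  forall A : set (measurableTypeR R), measurable A -> P (X @^-1` A) = nu A.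

(* As self-decomposability is a property of the law, the probability space
   carrying the independent pair (X, Xc) may be chosen depending on c. *)
Definition self_decomposable (R : realType)
    (nu : probability (measurableTypeR R) R) : Prop :=
  forall c : R, 0 < c < 1 ->
    exists (d : measure_display) (T : measurableType d) (P : probability T R)
           (X Xc : {RV P >-> measurableTypeR R}),
      [/\ has_law P X nu,
          independent_RV P X Xc
        & has_law P (fun w => Xc w + c * X w) nu].

(* Main.v *)
From HB Require Import structures.
Require Import Defs.
From mathcomp Require Import all_boot all_order all_algebra.
From mathcomp Require Import all_classical all_reals all_analysis.
From mathcomp Require Import measurable_realfun polyrcf lra ring zify.
Import Order.TTheory GRing.Theory Num.Theory.
Import numFieldNormedType.Exports.
Local Open Scope classical_set_scope.
Local Open Scope ring_scope.
Set Implicit Arguments.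
Unset Strict Implicit.
Unset Printing Implicit Defensive.

(* With F(z) = sum_k z^k / (k! (mu+1)_k), rho_{mu,a}(x) = 1 / F(a^2 x / 4).
   F is the pointwise limit on [0, +oo[ of rescaled Laguerre polynomials, which
   are real-rooted with negative roots by Rolle's theorem applied to their
   Rodrigues formula.  By compactness F(z) = e^(alpha z) prod_i (1 + lam_i z)
   with alpha, lam_i >= 0 and sum_i lam_i < +oo; alpha is in fact 0, but this is
   irrelevant since a generalized gamma convolution may have a drift.
   Hence rho is the Laplace transform of the law of alpha + sum_i lam_i E_i (up
   to the factor a^2 / 4) with E_i independent exponential variables.  This law
   is built as the decreasing limit of the distribution functions of the partial
   sums.  Its Thorin measure is sum_i delta_(1 / lam_i), and it is
   self-decomposable because E has the law of c E + B E', where B is Bernoulli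
   with P(B = 1) = 1 - c; this survives independent sums and the limit. *)

(** * Real-rootedness of Laguerre polynomials *)

(** The factorization of F uses real polynomials only, with no Hadamard factorization and no
    location of the zeros of [I_mu]. The obstacle is that a pointwise limit of products prod (1 +
    l_i z) can lose mass into ever smaller factors. The loss is controlled by a bound on sum l_i,
    which comes from the value at z = 1: 1 + sum l_i <= prod (1 + l_i) <= F(1). On the probabilistic
    side, adding a nonnegative variable can only lower a distribution function. Hence the partial
    sums converge at every point, not merely at continuity points of the limit, and limits pass
    through convolutions by dominated convergence. Laplace transforms are covered too, being values
    at 0 of distribution functions of convolutions. Monotonicity alone does not prevent mass from
    escaping to infinity; the bound on sum lam_i does. *)

Section alternation.
Variable R : rcfType.
Implicit Types (p q : {poly R}) (s t : seq R).

Definition sign_change p : rel R :=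
  fun x y => (x < y) && (p.[x] * p.[y] < 0).

Lemma sign_change_path_last p x s : path (sign_change p) x s -> x <= last x s.
Proof.
elim: s x => //= y s IH x /andP[/andP[xy _] /IH ys].
exact: le_trans (ltW xy) ys.
Qed.

(** The intermediate value theorem puts one root in each gap; the gaps are disjoint and ordered, so
    the roots are distinct. *)
Lemma sign_change_roots p x s : path (sign_change p) x s ->
  exists t, [/\ size t = size s, sorted <%R t, all (root p) t
              & all (fun y => x < y < last x s) t].
Proof.
elim: s x => [|y s IH] x /=; first by exists [::].
move=> /andP[/andP[xy pxy] ps].
have [t [szt st rt bt]] := IH _ ps.
have [z] := poly_ivtoo (ltW xy) pxy.
rewrite in_itv/= => /andP[xz zy] rz.
exists (z :: t); split=> /=; first by rewrite szt.
- rewrite path_sortedE; last exact: lt_trans.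
  rewrite st andbT; apply: sub_all bt => u /andP[yu _].
  exact: lt_trans zy yu.
- by rewrite rz.
- rewrite xz (lt_le_trans zy (sign_change_path_last ps))/=.
  apply: sub_all bt => u /andP[yu ->].
  by rewrite (lt_trans xy yu).
Qed.

Lemma sgr_prod_gt s x : all (fun y => x < y) s ->
  Num.sg (\prod_(y <- s) ('X - y%:P)).[x] = (-1) ^+ size s.
Proof.
elim: s => [|y s IH]/=; first by rewrite big_nil hornerC sgr1.
move=> /andP[xy /IH H]; rewrite big_cons hornerM sgrM H hornerXsubC exprS.
by rewrite ltr0_sg// subr_lt0.
Qed.

Lemma sgr_prod_lt s x : all (fun y => y < x) s ->
  Num.sg (\prod_(y <- s) ('X - y%:P)).[x] = 1.
Proof.
elim: s => [|y s IH]/=; first by rewrite big_nil hornerC sgr1.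
move=> /andP[xy /IH H]; rewrite big_cons hornerM sgrM H hornerXsubC mulr1.
by rewrite gtr0_sg// subr_gt0.
Qed.

(* One differentiation in a Rodrigues formula: the derivative of
   [x^beta e^x q(x)] is [x^(beta-1) e^x (rodrigues beta q)(x)]. *)
Definition rodrigues (beta : R) q := 'X * q^`() + (beta%:P + 'X) * q.

Lemma rodrigues_monic beta s (q := \prod_(y <- s) ('X - y%:P)) :
  rodrigues beta q \is monic /\ size (rodrigues beta q) = (size s).+2.
Proof.
have mq : q \is monic by exact: monic_prod_XsubC.
have szq : size q = (size s).+1 by rewrite size_prod_XsubC.
have -> : rodrigues beta q = q * 'X + ('X * q^`() + beta%:P * q).
  by rewrite /rodrigues; ring.
have sz1 : size (q * 'X) = (size s).+2.
  by rewrite size_mulX ?szq// -size_poly_eq0 szq.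
have lt : (size ('X * q^`() + beta%:P * q)%R < size (q * 'X)%R)%N.
  rewrite sz1 ltnS (leq_trans (size_polyD _ _))// geq_max; apply/andP; split.
    have [->|q'0] := eqVneq q^`() 0; first by rewrite mulr0 size_poly0.
    by rewrite mulrC size_mulX// -szq lt_size_deriv// -size_poly_eq0 szq.
  by rewrite mul_polyC (leq_trans (size_scale_leq _ _))// szq.
split; last by rewrite size_polyDl.
by rewrite monicE lead_coefDl// lead_coefMX -monicE.
Qed.

(** At a root [a] of q only the term x q'(x) survives, and q'(a) is the product of a - y over the
    other roots. Its sign flips from each root to the next, which is Rolle's theorem with explicit
    signs. *)
Lemma sgr_rodrigues beta s1 s2 a : sorted <%R (s1 ++ a :: s2) -> a < 0 ->
  Num.sg (rodrigues beta (\prod_(y <- s1 ++ a :: s2) ('X - y%:P))).[a]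
  = (-1) ^+ (size s2).+1.
Proof.
move=> srt a0.
pose p1 := \prod_(y <- s1) ('X - y%:P); pose p2 := \prod_(y <- s2) ('X - y%:P).
have -> : \prod_(y <- s1 ++ a :: s2) ('X - y%:P) = p1 * (('X - a%:P) * p2).
  by rewrite big_cat big_cons.
have -> : (rodrigues beta (p1 * (('X - a%:P) * p2))).[a] = a * (p1.[a] * p2.[a]).
  rewrite /rodrigues !(derivM, derivB, derivX, derivC).
  rewrite !(hornerD, hornerM, hornerN, hornerX, hornerC).
  by ring.
move: srt; rewrite sorted_pairwise; last exact: lt_trans.
rewrite pairwise_cat => /and3P[/allrelP h1 _]; rewrite pairwise_cons => /andP[h2 _].
rewrite !sgrM ltr0_sg// sgr_prod_lt ?sgr_prod_gt ?mul1r// -?exprS//.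
by apply/allP => y ys; apply: h1 => //; rewrite mem_head.
Qed.

(** Past the last root the chain is extended by 0, where the value is beta q(0) > 0; this is the
    role of beta > 0. The induction runs over suffixes of [s], and the prefix [s1] locates [a] in
    [s]. *)
Lemma sgr_rodrigues_path beta s : sorted <%R s -> all (< 0) s -> 0 < beta ->
  let T := rodrigues beta (\prod_(y <- s) ('X - y%:P)) in
  forall s2 s1 a, s = s1 ++ a :: s2 -> path (sign_change T) a (rcons s2 0).
Proof.
move=> srt neg b0 T.
have T0 : Num.sg T.[0] = 1.
  rewrite /T /rodrigues !hornerE sgrM sgr_prod_lt//.
  by rewrite gtr0_sg// mulr1.
elim=> [|b s2 IH] s1 a sE /=.
  have a0 : a < 0 by apply: (allP neg); rewrite sE mem_cat mem_head orbT.
  have := @sgr_rodrigues beta s1 [::] a; rewrite -sE => /(_ srt a0) Ta.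
  by rewrite /sign_change a0 -sgr_cp0 sgrM T0 Ta /= expr1 mulr1 eqxx.
rewrite (IH (rcons s1 a) b) ?cat_rcons// andbT.
have a0 : a < 0 by apply: (allP neg); rewrite sE mem_cat mem_head orbT.
have bs0 : b < 0.
  by apply: (allP neg); rewrite sE mem_cat !inE eqxx !orbT.
have := @sgr_rodrigues beta s1 (b :: s2) a; rewrite -sE => /(_ srt a0) Ta.
have := @sgr_rodrigues beta (rcons s1 a) s2 b.
rewrite cat_rcons -sE => /(_ srt bs0) Tb.
rewrite /sign_change; apply/andP; split.
  move: srt; rewrite sE sorted_pairwise; last exact: lt_trans.
  by rewrite pairwise_cat => /and3P[_ _ /=] /andP[/andP[]].
by rewrite -sgr_cp0 sgrM Ta Tb /= exprS -mulrA -expr2 sqrr_sign mulr1.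
Qed.

Lemma minfty_sign p : p \is monic ->
  exists M0, forall x, x <= M0 -> Num.sg p.[x] = (-1) ^+ (size p).-1.
Proof.
move=> mp; exists (- cauchy_bound p) => x xM.
have p0 : p != 0 by exact: monic_neq0.
rewrite (@sgp_minftyP _ (- cauchy_bound p) p)//.
- by rewrite /sgp_minfty (monicP mp) mulr1 sgrX sgrN1.
- by move=> y; exact: le_cauchy_bound.
Qed.

Lemma rodrigues_alternates beta s : sorted <%R s -> all (< 0) s -> 0 < beta ->
  exists M, path (sign_change (rodrigues beta (\prod_(y <- s) ('X - y%:P))))
                 M (rcons s 0).
Proof.
move=> srt neg b0.
have HP := sgr_rodrigues_path srt neg b0.
have [mT szT] := rodrigues_monic beta s.
have [M0 HM0] := minfty_sign mT.
(* [M] must lie left of the next point of the chain, which is the first root, or 0 when [s] is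
   empty; the default of [head] covers both cases. *)
exists (Num.min M0 (head 0 s - 1)); set M := Num.min _ _.
have TM : Num.sg (rodrigues beta (\prod_(y <- s) ('X - y%:P))).[M]
          = (-1) ^+ (size s).+1.
  by rewrite HM0 ?szT// ge_min lexx.
have Mh : M < head 0 s by rewrite gt_min; apply/orP; right; lra.
move: M TM Mh => M TM Mh {HM0 M0 mT szT}.
case: s srt neg HP TM Mh => [|a s] srt neg HP TM Mh.
  rewrite /= /sign_change Mh -sgr_cp0 sgrM TM/= andbT.
  rewrite /rodrigues big_nil derivC mulr0 add0r mulr1 !(hornerD, hornerX, hornerC).
  by rewrite addr0 gtr0_sg// mulr1 expr1.
rewrite /= (HP s [::] a)// andbT /sign_change Mh/=.
have a0 : a < 0 by move: neg => /= /andP[].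
have := @sgr_rodrigues beta [::] s a srt a0; rewrite cat0s => Ta.
by rewrite -sgr_cp0 sgrM TM Ta/= exprS -mulrA -expr2 sqrr_sign mulr1.
Qed.

(** The chain from [M] through the roots to 0 has as many gaps as the degree of the new polynomial,
    so the roots found are all of them. *)
Lemma rodrigues_real_rooted beta s : sorted <%R s -> all (< 0) s -> 0 < beta ->
  exists t, [/\ size t = (size s).+1, sorted <%R t, all (< 0) t &
    rodrigues beta (\prod_(y <- s) ('X - y%:P)) = \prod_(y <- t) ('X - y%:P)].
Proof.
move=> srt neg b0; have [M pth] := rodrigues_alternates srt neg b0.
have [mT szT] := rodrigues_monic beta s.
have [t [szt st rt bt]] := sign_change_roots pth.
exists t; split=> //; first by rewrite szt size_rcons.
  by apply: sub_all bt => y /andP[_]; rewrite last_rcons.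
rewrite {1}(@all_roots_prod_XsubC _ (rodrigues _ _) t)//.
- by rewrite (monicP mT) scale1r.
- by rewrite szT szt size_rcons.
- by rewrite uniq_rootsE; apply: (sorted_uniq lt_trans) => //; exact: ltxx.
Qed.

End alternation.

(** * Laguerre polynomials: coefficients and factorization *)

Section rodrigues_sequence.
Variable R : rcfType.

Definition pochhammer (b : R) n := \prod_(i < n) (b + i%:R).

Lemma pochhammerS b n : pochhammer b n.+1 = pochhammer b n * (b + n%:R).
Proof. by rewrite /pochhammer big_ord_recr. Qed.

Lemma pochhammer_gt0 b n : 0 < b -> 0 < pochhammer b n.
Proof. by move=> b0; apply: prodr_gt0 => i _; rewrite ltr_wpDr. Qed.

(** The product lists the last d factors in decreasing order. With N = b + n - 1 it turns the
    falling factorials of N into (b)_n / (b)_k. *)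
Lemma pochhammer_tail b k d :
  pochhammer b k * \prod_(i < d) (b + (k + d)%:R - 1 - i%:R) = pochhammer b (k + d).
Proof.
elim: d => [|d IH]; first by rewrite big_ord0 mulr1 addn0.
rewrite big_ord_recl addnS pochhammerS -IH -mulrA; congr (_ * _).
rewrite mulrC; congr (_ * _); last by rewrite -natr1 /=; ring.
by apply: eq_bigr => i _; rewrite lift0 -!natr1; ring.
Qed.

(** x^(N-m) e^x times this polynomial is the m-th derivative of x^N e^x; in classical notation it is
    m! L_m^(N-m)(-x). *)
Fixpoint rodrigues_poly (N : R) m : {poly R} :=
  if m is m'.+1 then rodrigues (N - m'%:R) (rodrigues_poly N m') else 1.

Lemma coef_rodrigues beta (q : {poly R}) k :
  (rodrigues beta q)`_k = (k%:R + beta) * q`_k + (if k is j.+1 then q`_j else 0).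
Proof.
rewrite /rodrigues mulrDl !coefD coefXM coefCM coefXM; case: k => [|k] /=.
  by ring.
by rewrite coef_deriv -mulr_natr; ring.
Qed.

(** This is the Leibniz rule for the m-th derivative of x^N e^x, proved by way of Pascal's rule. *)
Lemma coef_rodrigues_poly N m k :
  (rodrigues_poly N m)`_k = 'C(m, k)%:R * \prod_(i < m - k) (N - i%:R).
Proof.
elim: m k => [|m IH] k.
  by rewrite sub0n big_ord0 mulr1 coef1 bin0n; case: k.
rewrite /= coef_rodrigues IH; case: k => [|k].
  by rewrite !bin0 !subn0 big_ord_recr/=; ring.
rewrite IH binS natrD subSS; have [km|mk] := leqP k.+1 m.
  have -> : (m - k = (m - k.+1).+1)%N by lia.
  rewrite big_ord_recr/= (natrB _ km); ring.
by rewrite bin_small// !mul0r mulr0 !add0r.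
Qed.

Lemma size_rodrigues_poly N m : (size (rodrigues_poly N m) <= m.+1)%N.
Proof.
apply/leq_sizeP => k mk; rewrite coef_rodrigues_poly bin_small ?mul0r//.
Qed.

Lemma rodrigues_poly_real_rooted N m : (forall i, (i < m)%N -> i%:R < N) ->
  exists t, [/\ size t = m, sorted <%R t, all (< 0) t &
    rodrigues_poly N m = \prod_(y <- t) ('X - y%:P)].
Proof.
elim: m => [_|m IH Nm]; first by exists [::]; rewrite big_nil.
have [i im|t [szt st nt tE]] := IH; first by apply: Nm; exact: leqW.
have Nm0 : 0 < N - m%:R by rewrite subr_gt0 Nm.
have [u [szu su nu uE]] := rodrigues_real_rooted st nt Nm0.
by exists u; split=> //=; [rewrite szu szt|rewrite tE uE].
Qed.

(** For N = b + n - 1 the sum is the Laguerre polynomial at z / n divided by its constant term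
    (b)_n. The rescaling by n is what makes the k-th coefficient tend to 1 / (k! (b)_k). *)
Lemma laguerre_factor b n : 0 < b -> exists l : nat -> R,
  [/\ forall i, 0 <= l i, forall i j, (i <= j)%N -> l j <= l i &
      forall z, \sum_(k < n.+1) 'C(n, k)%:R * (z / n%:R) ^+ k / pochhammer b k
                = \prod_(i < n) (1 + l i * z)].
Proof.
move=> b0; set N := b + n%:R - 1.
have [i ni|t [szt st nt tE]] := @rodrigues_poly_real_rooted N n.
  have : (i.+1%:R <= n%:R :> R) by rewrite ler_nat.
  by rewrite -natr1 /N => ?; lra.
pose r := rev t.
have szr : size r = n by rewrite size_rev.
have rlt0 i : (i < n)%N -> nth 0 r i < 0.
  by move=> ni; apply: (allP nt); rewrite -mem_rev mem_nth// szr.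
have sr : sorted >%R r by rewrite rev_sorted.
have n0 i : (i < n)%N -> 0 < n%:R :> R by move=> ni; rewrite ltr0n (leq_trans _ ni).
(* The roots are listed from the one nearest to 0, so that [l] is nonincreasing. For i >= n the
   default root 0 gives l i = 0, since 0^-1 = 0. *)
pose l i := - (n%:R * nth 0 r i)^-1.
have l0 i : 0 <= l i.
  rewrite oppr_ge0 invr_le0; have [ni|ni] := ltnP i n.
    by rewrite nmulr_lle0// ?rlt0//.
  by rewrite nth_default ?szr// mulr0.
exists l; split => //.
  move=> i j ij; have [nj|nj] := ltnP j n; last first.
    by rewrite {1}/l (nth_default _ (_ : size r <= j)%N) ?szr// mulr0 invr0 oppr0.
  have ni := leq_ltn_trans ij nj.
  have neg k : (k < n)%N -> n%:R * nth 0 r k < 0.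
    by move=> nk; rewrite pmulr_rlt0 ?rlt0// (n0 _ nk).
  rewrite /l lerN2 lef_nV2 ?negrE ?neg//.
  rewrite ler_pM2l ?(n0 _ nj)//; move: ij; rewrite leq_eqVlt => /orP[/eqP->//|ij].
  apply/ltW; apply: (sorted_ltn_nth _ 0 sr) => //; rewrite ?inE ?szr//.
  by move=> x y w; rewrite /= => xy wx; exact: lt_trans wx xy.
move=> z.
have PE w : \sum_(k < n.+1) 'C(n, k)%:R * w ^+ k / pochhammer b k * pochhammer b n
    = \prod_(i < n) (w - nth 0 r i).
  transitivity (rodrigues_poly N n).[w].
    rewrite (horner_coef_wide _ (size_rodrigues_poly N n)).
    apply: eq_bigr => k _; rewrite coef_rodrigues_poly.
    have kn : (k <= n)%N by rewrite -ltnS.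
    have := pochhammer_tail b k (n - k); rewrite subnKC// -/N => <-.
    have := pochhammer_gt0 k b0 => /lt0r_neq0 bk.
    by field.
  rewrite tE horner_prod (eq_bigr (fun y => w - y)); last first.
    by move=> y _; rewrite hornerXsubC.
  by rewrite -big_rev/= -/r (big_nth 0) szr big_mkord.
have P0 : pochhammer b n = \prod_(i < n) (- nth 0 r i).
  have := PE 0; rewrite big_ord_recl expr0 big1 ?addr0; last first.
    by move=> i _; rewrite lift0 expr0n/= mulr0 !mul0r.
  rewrite bin0 mulr1 /pochhammer big_ord0 divr1 mul1r => ->.
  by apply: eq_bigr => i _; rewrite sub0r.
apply: (mulIf (lt0r_neq0 (pochhammer_gt0 n b0))).
rewrite mulr_suml PE P0 -big_split/=; apply: eq_bigr => i _.
rewrite /l; have := rlt0 i (ltn_ord i) => /ltr0_neq0 r0.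
have := n0 i (ltn_ord i) => /lt0r_neq0 nn0.
by field; rewrite r0 nn0.
Qed.

End rodrigues_sequence.

(** * The product formula *)

Section product_limit.
Variable R : realType.

Lemma bounded_cvg_ultra (U : set_system nat) (UU : UltraFilter U)
    (u : nat -> R) (a b : R) :
  (forall n, a <= u n <= b) -> exists l : R, u n @[n --> U] --> l.
Proof.
move=> ub; have PU : ProperFilter U by exact: ultra_proper.
have Uab : (u @ U) `[a, b]%classic.
  by apply: (@filterE _ U _) => n; rewrite /= in_itv/=.
have [p [_ clp]] := @segment_compact R a b (u @ U) _ Uab.
exists p => B pB; case: (in_ultra_setVsetC (u @^-1` B) UU) => // UnB.
by have [x [nBx Bx]] := clp (~` B) _ UnB pB.
Qed.

(** exp(x^2 - x) >= 1 - x + x^2, and (1 + x)(1 - x + x^2) = 1 + x^3 >= 1. *)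
Lemma expRB_sqr_le1D (x : R) : 0 <= x -> expR (x - x ^+ 2) <= 1 + x.
Proof.
move=> x0; have h : 0 < 1 - x + x ^+ 2 by nra.
have -> : x - x ^+ 2 = - (x ^+ 2 - x) by ring.
rewrite expRN; apply: (@le_trans _ _ (1 - x + x ^+ 2)^-1).
  rewrite lef_pV2 ?posrE ?expR_gt0//; apply: le_trans (expR_ge1Dx _).
  by rewrite addrCA addrC; lra.
by rewrite -div1r ler_pdivrMr//; nra.
Qed.

Lemma prodr1D_le_expR (I : Type) (r : seq I) (f : I -> R) : (forall i, 0 <= f i) ->
  \prod_(i <- r) (1 + f i) <= expR (\sum_(i <- r) f i).
Proof.
move=> f0; rewrite expR_sum; apply: ler_prod => i _.
by rewrite addr_ge0// expR_ge1Dx.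
Qed.

Lemma expR_le_prodr1D (I : Type) (r : seq I) (f : I -> R) : (forall i, 0 <= f i) ->
  expR (\sum_(i <- r) f i - \sum_(i <- r) f i ^+ 2) <= \prod_(i <- r) (1 + f i).
Proof.
move=> f0; rewrite -sumrB expR_sum; apply: ler_prod => i _.
by rewrite expR_ge0 expRB_sqr_le1D.
Qed.

Lemma cvg_prod_ord (T : Type) (U : set_system T) {PU : Filter U}
    (f : nat -> T -> R) (g : nat -> R) k :
  (forall i, f i n @[n --> U] --> g i) ->
  \prod_(i < k) f i n @[n --> U] --> \prod_(i < k) g i.
Proof.
move=> fg; elim: k => [|k IH].
  rewrite big_ord0; under eq_cvg do rewrite big_ord0; exact: cvg_cst.
rewrite big_ord_recr/=; under eq_cvg do rewrite big_ord_recr/=.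
exact: cvgM.
Qed.

Lemma cvg_sum_ord (T : Type) (U : set_system T) {PU : Filter U}
    (f : nat -> T -> R) (g : nat -> R) k :
  (forall i, f i n @[n --> U] --> g i) ->
  \sum_(i < k) f i n @[n --> U] --> \sum_(i < k) g i.
Proof.
move=> fg; elim: k => [|k IH].
  rewrite big_ord0; under eq_cvg do rewrite big_ord0; exact: cvg_cst.
rewrite big_ord_recr/=; under eq_cvg do rewrite big_ord_recr/=.
exact: cvgD.
Qed.

Lemma big_ord_cat (T : Type) (idx : T) (op : Monoid.law idx) (f : nat -> T) k n :
  (k <= n)%N -> \big[op/idx]_(i < n) f i
    = op (\big[op/idx]_(i < k) f i) (\big[op/idx]_(k <= i < n) f i).
Proof. by move=> kn; rewrite -!(big_mkord xpredT) (big_cat_nat (leq0n k) kn). Qed.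

(* Compactness in the Laguerre-Polya theorem: a limit of products with
   nonnegative decreasing factors is a product of the same kind, up to an
   exponential which collects the mass of the factors going to 0. *)
Lemma cvg_prod_factor (F : R -> R) (C : R) (l : nat -> nat -> R) :
  (forall n i, 0 <= l n i) ->
  (forall n i j, (i <= j)%N -> l n j <= l n i) ->
  (forall n, \sum_(i < n) l n i <= C) ->
  (forall z, 0 <= z -> \prod_(i < n) (1 + l n i * z) @[n --> \oo] --> F z) ->
  exists (alpha : R) (lam : nat -> R),
    [/\ 0 <= alpha, forall i, 0 <= lam i, forall k, \sum_(i < k) lam i <= C &
     forall z, 0 <= z ->
       \prod_(i < k) (1 + lam i * z) @[k --> \oo] --> F z * expR (- (alpha * z))].
Proof.
move=> l0 lnd lC lF.
(* Along an ultrafilter refining the filter at infinity, all the [l n i] and their total sums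
   converge at once, which replaces a diagonal extraction. *)
have [U [UU subU]] := ultraFilterLemma (@eventually_filter).
have PU : ProperFilter U by exact: ultra_proper.
have C0 : 0 <= C by apply: le_trans (lC 0); rewrite big_ord0.
have sumC n k : (k <= n)%N -> \sum_(i < k) l n i <= C.
  move=> kn; apply: le_trans (lC n).
  rewrite (big_ord_cat _ (l n) kn)/= lerDl.
  by apply: sumr_ge0.
(* The first i + 1 terms are all at least [l n i], and their sum is at most C. *)
have lbd n i : (i < n)%N -> l n i <= C / i.+1%:R.
  move=> ni; rewrite ler_pdivlMr//; apply: le_trans (sumC _ _ ni).
  rewrite mulr_natr -[X in _ *+ X]card_ord -sumr_const; apply: ler_sum => j _.
  by apply: lnd; rewrite -ltnS.
have subUn (P : set nat) k : (forall n, (k <= n)%N -> P n) -> U P.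
  by move=> kP; apply: subU; exists k.
have /choice[lam Hlam] i : exists x : R, l n i @[n --> U] --> x.
  (* [l n i] is only bounded for i < n; the truncation alters finitely many n, which [U] does not
     see. *)
  pose u n := if (i < n)%N then l n i else 0.
  have [x ux] : exists x : R, u n @[n --> U] --> x.
    apply: (@bounded_cvg_ultra U UU u 0 C) => n; rewrite /u.
    case: ifPn => [ni|]; last by rewrite lexx C0.
    rewrite l0 (le_trans (lbd _ _ ni))// ler_pdivrMr// ler_peMr//.
    by rewrite -[1]/(1%:R) ler_nat.
  exists x; apply: cvg_trans ux; apply: near_eq_cvg.
  by apply: (subUn _ i.+1) => n ni; rewrite /u ni.
have [A HA] : exists A : R, \sum_(i < n) l n i @[n --> U] --> A.
  apply: (@bounded_cvg_ultra U UU _ 0 C) => n; rewrite lC andbT.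
  by apply: sumr_ge0.
have lam0 i : 0 <= lam i.
  by apply: (cvgr_to_ge (Hlam i)); exact: nearW.
(* The factors of index >= k are squeezed between exponentials of z times the tail sum. The defect
   is z^2 times the tail sum of squares, at most z^2 C^2 / (k + 1) by [lbd]. Only then does n go to
   the limit along [U]. *)
have bounds k z : 0 <= z ->
    \prod_(i < k) (1 + lam i * z)
      * expR (z * (A - \sum_(i < k) lam i) - z ^+ 2 * (C ^+ 2 / k.+1%:R)) <= F z
    <= \prod_(i < k) (1 + lam i * z) * expR (z * (A - \sum_(i < k) lam i)).
  move=> z0.
  have FU : \prod_(i < n) (1 + l n i * z) @[n --> U] --> F z.
    exact: cvg_trans (cvg_app _ subU) (lF z z0).
  have PU1 : \prod_(i < k) (1 + l n i * z) @[n --> U] --> \prod_(i < k) (1 + lam i * z).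
    apply: (@cvg_prod_ord nat U _ (fun i n => 1 + l n i * z) (fun i => 1 + lam i * z)).
    by move=> i; apply: cvgD; [exact: cvg_cst|apply: cvgM => //; exact: cvg_cst].
  have TU : z * (\sum_(i < n) l n i - \sum_(i < k) l n i) @[n --> U]
      --> z * (A - \sum_(i < k) lam i).
    apply: cvgM; first exact: cvg_cst.
    by apply: cvgB => //; exact: (@cvg_sum_ord nat U _ (fun i n => l n i)).
  have tail n : (k <= n)%N -> \sum_(i < n) l n i - \sum_(i < k) l n i
      = \sum_(k <= i < n) l n i.
    by move=> kn; rewrite (big_ord_cat _ (l n) kn)/= addrAC subrr add0r.
  have ptail n : (k <= n)%N -> \prod_(i < n) (1 + l n i * z) =
      \prod_(i < k) (1 + l n i * z) * \prod_(k <= i < n) (1 + l n i * z).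
    by move=> kn; rewrite (big_ord_cat _ (fun i => 1 + l n i * z) kn).
  have P0 n : 0 <= \prod_(i < k) (1 + l n i * z).
    by apply: prodr_ge0 => i _; rewrite addr_ge0 ?mulr_ge0.
  apply/andP; split.
    have low : \prod_(i < k) (1 + l n i * z) *
        expR (z * (\sum_(i < n) l n i - \sum_(i < k) l n i)
              - z ^+ 2 * (C ^+ 2 / k.+1%:R)) @[n --> U]
      --> \prod_(i < k) (1 + lam i * z) *
        expR (z * (A - \sum_(i < k) lam i) - z ^+ 2 * (C ^+ 2 / k.+1%:R)).
      apply: cvgM => //.
      apply: continuous_cvg; first exact: continuous_expR.
      by apply: cvgB => //; exact: cvg_cst.
    apply: (ler_cvg_to low FU).
    apply: (subUn _ k) => n kn /=.
    rewrite ptail// ler_wpM2l// tail//.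
    apply: le_trans (expR_le_prodr1D _ _); last by move=> i; rewrite mulr_ge0.
    rewrite ler_expR -mulr_suml mulrC lerB//.
    under eq_bigr do rewrite exprMn.
    rewrite -mulr_suml mulrC ler_wpM2l ?exprn_ge0//.
    apply: (@le_trans _ _ (\sum_(k <= i < n) C / k.+1%:R * l n i)).
      rewrite big_nat_cond [leRHS]big_nat_cond; apply: ler_sum => i /andP[/andP[ki ni] _].
      rewrite expr2 ler_wpM2r// (le_trans (lnd _ _ _ ki))// lbd//.
      exact: leq_ltn_trans ni.
    rewrite -mulr_sumr -tail// [leRHS](_ : _ = C / k.+1%:R * C); last first.
      by rewrite expr2 mulrAC.
    rewrite ler_wpM2l ?divr_ge0//.
    by rewrite lerBlDr (le_trans (lC n))// lerDl sumr_ge0.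
  have up : \prod_(i < k) (1 + l n i * z) *
        expR (z * (\sum_(i < n) l n i - \sum_(i < k) l n i)) @[n --> U]
      --> \prod_(i < k) (1 + lam i * z) * expR (z * (A - \sum_(i < k) lam i)).
    apply: cvgM => //.
    by apply: continuous_cvg; first exact: continuous_expR.
  apply: (ler_cvg_to FU up).
  apply: (subUn _ k) => n kn /=.
  rewrite ptail// ler_wpM2l// tail//.
  apply: le_trans (prodr1D_le_expR _ _) _; first by move=> i; rewrite mulr_ge0.
  by rewrite -mulr_suml mulrC.
have sumlam k : \sum_(i < k) lam i <= A.
  apply: (ler_cvg_to (@cvg_sum_ord nat U _ (fun i n => l n i) _ k Hlam) HA).
  apply: (subUn _ k) => n kn /=.
  rewrite (big_ord_cat _ (l n) kn)/= lerDl.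
  by apply: sumr_ge0.
have AC : A <= C by apply: (cvgr_to_le HA); exact: nearW.
have cvgS : cvgn (fun k => \sum_(i < k) lam i).
  apply: nondecreasing_is_cvgn.
    apply/nondecreasing_seqP => n; by rewrite big_ord_recr/= lerDl.
  by exists A => _ [k _ <-].
set L := limn (fun k => \sum_(i < k) lam i).
have LE : \sum_(i < k) lam i @[k --> \oo] --> L by exact: cvgS.
exists (A - L), lam; split=> //.
- by rewrite subr_ge0; apply: (cvgr_to_le LE); exact: nearW.
- by move=> k; exact: le_trans (sumlam k) AC.
move=> z z0.
have EL : expR (- (z * (A - \sum_(i < k) lam i))) @[k --> \oo]
    --> expR (- ((A - L) * z)).
  apply: continuous_cvg; first exact: continuous_expR.
  rewrite mulrC; apply: cvgN; apply: cvgM; first exact: cvg_cst.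
  by apply: cvgB => //; exact: cvg_cst.
(* [bounds] solved for the partial product: [U] has disappeared, so the convergence in k is ordinary
   convergence. *)
apply: (@squeeze_cvgr _ _ _ _ (fun k => F z * expR (- (z * (A - \sum_(i < k) lam i))))
   (fun k => F z * (expR (- (z * (A - \sum_(i < k) lam i)))
        * expR (z ^+ 2 * (C ^+ 2 * k.+1%:R^-1))))).
- apply: nearW => k; have /andP[b1 b2] := bounds k z z0; apply/andP; split.
    by rewrite expRN ler_pdivrMr ?expR_gt0.
  rewrite -expRD addrC -opprB expRN ler_pdivlMr ?expR_gt0//.
- by apply: cvgM => //; exact: cvg_cst.
- apply: cvgM; first exact: cvg_cst.
  rewrite -[X in _ --> X]mulr1 -[in X in _ --> X](@expR0 R).
  apply: cvgM => //; apply: continuous_cvg; first exact: continuous_expR.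
  have -> : 0 = z ^+ 2 * (C ^+ 2 * 0) by rewrite !mulr0.
  apply: cvgM; first exact: cvg_cst.
  by apply: cvgM; [exact: cvg_cst|exact: (@cvg_harmonic R)].
Qed.

End product_limit.

(** * The series 0F1 as a limit of rescaled Laguerre polynomials *)

Section hypergeometric.
Variable R : realType.

Definition hyp0F1_coeff (b z : R) (k : nat) : R := z ^+ k / (k`!%:R * pochhammer b k).

Definition hyp0F1 (b z : R) : R := limn (series (hyp0F1_coeff b z)).

Lemma hyp0F1_coeff_ge0 b z k : 0 < b -> 0 <= z -> 0 <= hyp0F1_coeff b z k.
Proof.
move=> b0 z0; rewrite divr_ge0 ?exprn_ge0// mulr_ge0//.
exact/ltW/pochhammer_gt0.
Qed.

(** The factors b + j with j >= 1 exceed 1. The bound is crude, but it suffices to compare the 0F1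
    series with a multiple of the exponential series. *)
Lemma pochhammer_ge (b : R) k : 0 < b -> Num.min 1 b <= pochhammer b k.
Proof.
move=> b0; case: k => [|k]; first by rewrite /pochhammer big_ord0 ge_min lexx.
rewrite ge_min; apply/orP; right.
elim: k => [|k IH]; first by rewrite pochhammerS /pochhammer big_ord0 mul1r addr0.
rewrite pochhammerS (le_trans IH)// ler_peMr//; first exact/ltW/pochhammer_gt0.
by rewrite -natr1; have := ler0n R k; lra.
Qed.

Lemma is_cvg_series_hyp0F1 b z : 0 < b -> 0 <= z -> cvgn (series (hyp0F1_coeff b z)).
Proof.
move=> b0 z0; set m := Num.min 1 b.
have m0 : 0 < m by rewrite lt_min ltr01.
apply: (@series_le_cvg _ _ (m^-1 *: exp_coeff z)).
- by move=> k; exact: hyp0F1_coeff_ge0.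
- by move=> k; rewrite mulr_ge0 ?invr_ge0 ?(ltW m0)// exp_coeff_ge0.
- move=> k; rewrite /hyp0F1_coeff invfM mulrA mulrC ler_wpM2r//.
    by rewrite exp_coeff_ge0.
  by rewrite lef_pV2 ?posrE ?pochhammer_gt0// pochhammer_ge.
- by apply: is_cvg_seriesZ; exact: is_cvg_series_exp_coeff.
Qed.

Lemma series_hyp0F1_le b z n : 0 < b -> 0 <= z ->
  series (hyp0F1_coeff b z) n <= hyp0F1 b z.
Proof.
move=> b0 z0; apply: nondecreasing_cvgn_le; last exact: is_cvg_series_hyp0F1.
by apply: nondecreasing_series => k _ _; exact: hyp0F1_coeff_ge0.
Qed.

(** The ratio of the k-th Laguerre term to the k-th 0F1 term. For k <= n and n > 0 it is the product
    of the 1 - j / n over j < k. *)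
Definition laguerre_coeff n k : R := 'C(n, k)%:R * k`!%:R / n%:R ^+ k.

Lemma laguerre_coeffS n k : (k <= n)%N -> (0 < n)%N ->
  laguerre_coeff n k.+1 = laguerre_coeff n k * (1 - k%:R / n%:R).
Proof.
move=> kn n0; rewrite /laguerre_coeff -!natrM !bin_ffact ffactnSr natrM (natrB _ kn).
by rewrite exprS; field; rewrite expf_neq0 pnatr_eq0 -lt0n n0.
Qed.

Lemma laguerre_coeff_ge0 n k : 0 <= laguerre_coeff n k.
Proof. by rewrite divr_ge0 ?exprn_ge0// mulr_ge0. Qed.

Lemma laguerre_coeff_le1 n k : (k <= n)%N -> laguerre_coeff n k <= 1.
Proof.
elim: k => [|k IH] kn; first by rewrite /laguerre_coeff bin0 fact0 expr0 mulr1 divr1.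
have n0 : (0 < n)%N by exact: leq_ltn_trans kn.
rewrite laguerre_coeffS ?(ltnW kn)//; apply: mulr_ile1.
- exact: laguerre_coeff_ge0.
- by rewrite subr_ge0 ler_pdivrMr ?ltr0n// mul1r ler_nat ltnW.
- by rewrite IH// ltnW.
- by rewrite gerBl divr_ge0.
Qed.

Lemma cvg_laguerre_coeff k : laguerre_coeff n k @[n --> \oo] --> (1 : R).
Proof.
elim: k => [|k IH].
  rewrite (_ : (fun n => _) = cst (1 : R)); first exact: cvg_cst.
  by apply/funext => n; rewrite /laguerre_coeff bin0 fact0 expr0 mulr1 divr1.
have : laguerre_coeff n k * (1 - k%:R / n%:R) @[n --> \oo] --> (1 * (1 - k%:R * 0) : R).
  apply: cvgM => //; apply: cvgB; first exact: cvg_cst.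
  apply: cvgM; first exact: cvg_cst.
  by have := @cvg_harmonic R; rewrite (cvg_shiftS (fun n => n%:R^-1 : R)).
rewrite mulr0 subr0 mulr1; apply: cvg_trans; apply: near_eq_cvg.
exists k.+1 => // n /= kn; rewrite -laguerre_coeffS// ?(ltnW kn)//.
exact: leq_ltn_trans kn.
Qed.

Lemma laguerre_coeff_hyp0F1 b z n k : 0 < b -> (k <= n)%N ->
  'C(n, k)%:R * (z / n%:R) ^+ k / pochhammer b k = laguerre_coeff n k * hyp0F1_coeff b z k.
Proof.
move=> b0; rewrite /laguerre_coeff /hyp0F1_coeff expr_div_n.
have := lt0r_neq0 (@pochhammer_gt0 R b k b0).
have : k`!%:R != 0 :> R by rewrite pnatr_eq0 -lt0n fact_gt0.
case: n => [|n] k0 p0 kn.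
  by move: kn k0 p0; rewrite leqn0 => /eqP -> _ p0; rewrite fact0 !expr0; field.
have n0 : n.+1%:R ^+ k != 0 :> R by rewrite expf_neq0// pnatr_eq0.
by field; rewrite n0 k0 p0.
Qed.

(** A case of Tannery's theorem: the terms are nonnegative and the weights at most 1, so the sum
    lies between its first K terms and F. The tail beyond K costs e / 2, the convergence of the
    first K weights the other e / 2. *)
Lemma cvg_laguerre_hyp0F1 b z : 0 < b -> 0 <= z ->
  \sum_(k < n.+1) laguerre_coeff n k * hyp0F1_coeff b z k @[n --> \oo] --> hyp0F1 b z.
Proof.
move=> b0 z0; apply/cvgrPdist_le => e e0.
have e20 : 0 < e / 2 by rewrite divr_gt0.
have sF : series (hyp0F1_coeff b z) n @[n --> \oo] --> hyp0F1 b z.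
  exact: is_cvg_series_hyp0F1.
move/cvgrPdist_le : sF => /(_ _ e20)[K _ HK].
have cK : \sum_(k < K) laguerre_coeff n k * hyp0F1_coeff b z k @[n --> \oo]
    --> \sum_(k < K) 1 * hyp0F1_coeff b z k.
  apply: (@cvg_sum_ord R _ \oo _ (fun k n => laguerre_coeff n k * hyp0F1_coeff b z k)
    (fun k => 1 * hyp0F1_coeff b z k)) => k.
  by apply: cvgM; [exact: cvg_laguerre_coeff|exact: cvg_cst].
move/cvgrPdist_le : cK => /(_ _ e20)[N _ HN].
exists (maxn K N) => // n /=; rewrite geq_max => /andP[Kn Nn].
have := HK K (leqnn K); have := HN n Nn => /=.
rewrite (_ : \sum_(k < K) 1 * _ = series (hyp0F1_coeff b z) K); last first.
  by rewrite seriesEord/=; apply: eq_bigr => k _; rewrite mul1r.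
set S := \sum_(k < K) _; set P := \sum_(k < n.+1) _; set F := hyp0F1 b z => h1 h2.
have SP : S <= P.
  rewrite /P (big_ord_cat _ (fun k => laguerre_coeff n k * hyp0F1_coeff b z k) (leqW Kn)).
  rewrite lerDl sumr_ge0// => k _.
  by rewrite mulr_ge0 ?laguerre_coeff_ge0 ?hyp0F1_coeff_ge0.
have PF : P <= F.
  apply: le_trans (series_hyp0F1_le n.+1 b0 z0); rewrite seriesEord/=.
  apply: ler_sum => k _; rewrite ler_piMl ?hyp0F1_coeff_ge0// laguerre_coeff_le1//.
  by rewrite -ltnS.
move: h1 h2; rewrite !ler_norml => /andP[a1 a2] /andP[a3 a4].
by apply/andP; split; lra.
Qed.

Lemma prodr1D_ge (f : nat -> R) n : (forall i, 0 <= f i) ->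
  1 + \sum_(i < n) f i <= \prod_(i < n) (1 + f i).
Proof.
move=> f0; elim: n => [|n IH]; first by rewrite !big_ord0 addr0.
rewrite !big_ord_recr/=; have := f0 n; have : 0 <= \sum_(i < n) f i by exact: sumr_ge0.
by nra.
Qed.

Lemma hyp0F1_factor b : 0 < b -> exists (alpha : R) (lam : nat -> R),
  [/\ 0 <= alpha, forall i, 0 <= lam i,
   exists C, forall k, \sum_(i < k) lam i <= C &
   forall z, 0 <= z ->
     \prod_(i < k) (1 + lam i * z) @[k --> \oo] --> hyp0F1 b z * expR (- (alpha * z))].
Proof.
move=> b0; have /choice[l Hl] n := @laguerre_factor R b n b0.
have lE n z : \prod_(i < n) (1 + l n i * z)
    = \sum_(k < n.+1) laguerre_coeff n k * hyp0F1_coeff b z k.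
  have [_ _ <-] := Hl n; apply: eq_bigr => k _.
  by apply: laguerre_coeff_hyp0F1; rewrite // -ltnS.
have [|||z z0|alpha [lam [a0 lam0 lamC H]]] := @cvg_prod_factor R (hyp0F1 b) (hyp0F1 b 1) l.
- by move=> n i; have [] := Hl n.
- by move=> n; have [] := Hl n.
(* The uniform bound on the sums comes from z = 1: 1 + sum l_i is at most the product, hence at most
   F(1). *)
- move=> n; have l0 i : 0 <= l n i by have [] := Hl n.
  have pE : \prod_(i < n) (1 + l n i) = \prod_(i < n) (1 + l n i * 1).
    by apply: eq_bigr => i _; rewrite mulr1.
  have := prodr1D_ge n l0; rewrite pE lE => h; apply: (@le_trans _ _ (1 + \sum_(i < n) l n i)).
    by rewrite lerDr.
  apply: (le_trans h); apply: le_trans (series_hyp0F1_le n.+1 b0 ler01).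
  rewrite seriesEord/=.
  apply: ler_sum => k _; rewrite ler_piMl ?hyp0F1_coeff_ge0// laguerre_coeff_le1//.
  by rewrite -ltnS.
- by under eq_cvg do rewrite lE; exact: cvg_laguerre_hyp0F1.
by exists alpha, lam; split => //; exists (hyp0F1 b 1).
Qed.

End hypergeometric.

(** * The Gamma function *)

Section gamma_function.
Variable R : realType.
Local Notation leb := (@lebesgue_measure R).

Definition gamma_fun (z t : R) : R := t `^ (z - 1) * expR (- t).

Lemma gamma_fun_ge0 z t : 0 <= gamma_fun z t.
Proof. by rewrite mulr_ge0 ?powR_ge0 ?expR_ge0. Qed.

Lemma measurable_gamma_fun z (D : set R) : measurable_fun D (gamma_fun z).
Proof.
apply: measurable_funTS; apply: measurable_funM; first exact: measurable_powR.
by apply: measurableT_comp => //; exact: measurable_funN.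
Qed.

Lemma continuous_powRl (p x : R) : 0 < x -> {for x, continuous (@powR R ^~ p)}.
Proof.
move=> x0; apply: differentiable_continuous; apply/derivable1_diffP.
by have [] := is_derive1_powR p x0.
Qed.

Lemma gamma_fun_by_parts (z a b : R) : 0 < a -> a < b ->
  (\int[leb]_(t in `[a, b]) (gamma_fun (z + 1) t)%:E =
   (a `^ z * expR (- a) - b `^ z * expR (- b))%:E
   + z%:E * \int[leb]_(t in `[a, b]) (gamma_fun z t)%:E)%E.
Proof.
move=> a0 ab; pose F t := t `^ z; pose f t := z * t `^ (z - 1).
pose G t : R := - expR (- t); pose g t : R := expR (- t).
have pos (t : R) : t \in `[a, b] -> 0 < t.
  by rewrite in_itv/= => /andP[+ _]; exact: lt_le_trans.
have b0 : 0 < b by exact: lt_trans ab.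
have cG (t : R) : {for t, continuous G}.
  by apply: continuousN; apply: continuous_comp; [exact: opp_continuous|exact: continuous_expR].
have dG (t : R) : is_derive t 1 G (g t).
  have h : is_derive t 1 (expR \o -%R) (expR (- t) * -1) by exact: is_derive1_comp.
  have -> : g t = - (expR (- t) * -1) by rewrite mulrN1 opprK.
  exact: is_deriveN.
have dF (t : R) : 0 < t -> is_derive t 1 F (f t) by move=> t0; exact: is_derive1_powR.
have wcF : {within `[a, b], continuous f}.
  apply: continuous_in_subspaceT => t /set_mem tab.
  by apply: cvgM; [exact: cvg_cst|apply: continuous_powRl; exact: pos].
have -> : (\int[leb]_(t in `[a, b]) (gamma_fun (z + 1) t)%:E =
    \int[leb]_(t in `[a, b]) (F t * g t)%:E)%E.
  by apply: eq_integral => t _; rewrite /gamma_fun addrK.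
rewrite (@integration_by_parts R F G f g a b ab)//.
- have -> : F b * G b - F a * G a = a `^ z * expR (- a) - b `^ z * expR (- b).
    by rewrite /F /G; ring.
  congr (_ + _)%E.
  have -> : (\int[leb]_(x in `[a, b]) (f x * G x)%:E
      = \int[leb]_(x in `[a, b]) ((- z)%:E * (gamma_fun z x)%:E))%E.
    apply: eq_integral => t _; rewrite -EFinM /f /G /gamma_fun; congr EFin; ring.
  rewrite integralZl//; first by rewrite EFinN mulNe oppeK.
  apply: continuous_compact_integrable => //; first exact: segment_compact.
  apply: continuous_in_subspaceT => t /set_mem tab; apply: cvgM.
    by apply: continuous_powRl; exact: pos.
  by apply: continuous_comp; [exact: opp_continuous|exact: continuous_expR].
- split.
  + by move=> t tab; have [] := dF t (pos _ (subset_itv_oo_cc tab)).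
  + by apply: cvg_at_right_filter; exact: continuous_powRl.
  + by apply: cvg_at_left_filter; exact: continuous_powRl.
- move=> t tab; rewrite derive1E; have h := dF t (pos _ (subset_itv_oo_cc tab)).
  by rewrite derive_val.
- apply: continuous_subspaceT => t.
  by apply: continuous_comp; [exact: opp_continuous|exact: continuous_expR].
- split.
  + by move=> t tab; have [] := dG t.
  + by apply: cvg_at_right_filter; exact: cG.
  + by apply: cvg_at_left_filter; exact: cG.
- by move=> t tab; rewrite derive1E derive_val.
Qed.

Lemma powR_le_expR (z : R) : 0 < z ->
  exists2 C, 0 <= C & forall t, 0 < t -> t `^ z <= C * expR (t / 2).
Proof.
move=> z0; pose m := (Num.truncn z).+1; have zm : z <= m%:R.
  by rewrite ltW// truncnS_gt.
have f1 : 1 <= 2 ^+ m * m`!%:R :> R.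
  by rewrite -natrX -natrM -[1]/(1%:R) ler_nat muln_gt0 expn_gt0 fact_gt0.
(* For t > 1, t^z <= t^m and e^(t/2) >= (t/2)^m / m!, which dictates the constant; for t <= 1 it is
   enough that the constant is at least 1. *)
exists (2 ^+ m * m`!%:R); first exact: le_trans f1.
move=> t t0; have [t1|t1] := leP t 1.
  apply: (@le_trans _ _ 1); first by have := ge0_ler_powR (ltW z0) (ltW t0) (@ler01 R) t1; rewrite powR1.
  rewrite (le_trans f1)// ler_peMr ?(le_trans ler01 f1)//.
  by rewrite -expR0 ler_expR divr_ge0// ltW.
apply: (@le_trans _ _ (t `^ m%:R)); first by rewrite ler_powR// ltW.
rewrite powR_mulrn ?(ltW t0)//.
have := @expR_ge1Dxn R (t / 2) (Num.truncn z) (ltW (divr_gt0 t0 (ltr0n _ 2))).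
rewrite -/m => h; rewrite -mulrA -ler_pdivrMl ?exprn_gt0//.
rewrite -ler_pdivrMl ?ltr0n ?fact_gt0//.
apply: le_trans h; rewrite expr_div_n.
by rewrite (_ : _ * _ = t ^+ m / 2 ^+ m / m`!%:R) ?lerDr// mulrC [_^-1 * t ^+ m]mulrC.
Qed.

(** The offset 2 keeps the endpoints distinct even for n = 0, as integration by parts requires. *)
Definition gamma_exhaust n : set R := `[n.+2%:R^-1, n.+2%:R]%classic.

Lemma gamma_exhaust_nd : nondecreasing_seq gamma_exhaust.
Proof.
move=> m n mn; apply/subsetPset => t; rewrite /gamma_exhaust /= !in_itv/= => /andP[h1 h2].
rewrite (le_trans _ h1) ?lef_pV2 ?posrE ?ltr0n// ?ler_nat ?ltnS//=.
by rewrite (le_trans h2)// ler_nat !ltnS.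
Qed.

Lemma bigcup_gamma_exhaust : \bigcup_n gamma_exhaust n = `]0, +oo[%classic.
Proof.
apply/seteqP; split=> t /=; rewrite in_itv/= andbT.
  move=> [n _]; rewrite /gamma_exhaust /= in_itv/= => /andP[h _].
  by rewrite (lt_le_trans _ h)// invr_gt0.
move=> t0; pose n := maxn (Num.truncn t) (Num.truncn t^-1).
exists n => //; rewrite /gamma_exhaust /= in_itv/=; apply/andP; split.
  rewrite -[leRHS]invrK lef_pV2 ?posrE ?invr_gt0// ?ltr0n//.
  by rewrite ltW// (lt_le_trans (truncnS_gt _))// ler_nat ltnS leqW// leq_maxr.
by rewrite ltW// (lt_le_trans (truncnS_gt _))// ler_nat ltnS leqW// leq_maxl.
Qed.

Lemma cvg_gamma_exhaust (z : R) :
  (\int[leb]_(t in gamma_exhaust n) (gamma_fun z t)%:E)%E @[n --> \oo] -->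
  (\int[leb]_(t in `]0%R, +oo[) (gamma_fun z t)%:E)%E.
Proof.
rewrite -bigcup_gamma_exhaust; apply: ge0_nondecreasing_set_cvg_integral.
- exact: gamma_exhaust_nd.
- by move=> n; exact: measurable_itv.
- by move=> n; apply/measurable_EFinP; exact: measurable_gamma_fun.
- by move=> n t _; rewrite lee_fin gamma_fun_ge0.
Qed.

Lemma cvg_gamma_boundary (z : R) : 0 < z ->
  n.+2%:R^-1 `^ z * expR (- n.+2%:R^-1) - n.+2%:R `^ z * expR (- n.+2%:R)
    @[n --> \oo] --> (0 : R).
Proof.
move=> z0; rewrite -[X in _ --> X](subr0 (0 : R)).
have h0 : n.+2%:R^-1 @[n --> \oo] --> (0 : R).
  by have := @cvg_harmonic R; rewrite -(cvg_shiftS (fun n => n.+1%:R^-1 : R)).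
apply: cvgB.
  have hp : (n.+2%:R^-1 `^ z) @[n --> \oo] --> (0 : R).
    have /cvg_at_rightP := powR_cvg0 z0.
    by apply; split => // n; rewrite invr_gt0.
  apply: (squeeze_cvgr _ (cvg_cst (0 : R)) hp); apply: nearW => n.
  rewrite mulr_ge0 ?powR_ge0 ?expR_ge0//= ler_piMr ?powR_ge0//.
have [C C0 HC] := powR_le_expR z0.
have hp : C * 2 * n.+2%:R^-1 @[n --> \oo] --> (0 : R).
  by rewrite -[X in _ --> X](mulr0 (C * 2)); apply: cvgM => //; exact: cvg_cst.
apply: (squeeze_cvgr _ (cvg_cst (0 : R)) hp); apply: nearW => n.
rewrite mulr_ge0 ?powR_ge0 ?expR_ge0//=.
have n0 : 0 < n.+2%:R :> R by [].
set b := n.+2%:R : R; apply: (@le_trans _ _ (C * expR (b / 2) * expR (- b))).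
  by rewrite ler_wpM2r ?expR_ge0 ?HC.
rewrite -!mulrA ler_wpM2l// -expRD (_ : b / 2 - b = - (b / 2)); last by field.
rewrite expRN (_ : 2 * b^-1 = (b / 2)^-1); last by rewrite invfM invrK mulrC.
rewrite lef_pV2 ?posrE ?expR_gt0 ?divr_gt0// (le_trans _ (expR_ge1Dx _))//.
by rewrite lerDr.
Qed.

Definition egamma (z : R) := (\int[leb]_(t in `]0%R, +oo[) (gamma_fun z t)%:E)%E.

(** Integration by parts on the compact intervals, then monotone convergence. Working in the
    extended reals presupposes no finiteness, which is deduced from this identity afterwards. *)
Lemma egammaS (z : R) : 0 < z -> egamma (z + 1) = (z%:E * egamma z)%E.
Proof.
move=> z0.
have h1 := @cvg_gamma_exhaust (z + 1).
have h2 := @cvg_gamma_exhaust z.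
suff h3 : (\int[leb]_(t in gamma_exhaust n) (gamma_fun (z + 1) t)%:E)%E
    @[n --> \oo] --> (z%:E * egamma z)%E by exact: (cvg_unique _ h1 h3).
rewrite (_ : (fun n => _) = (fun n =>
   (n.+2%:R^-1 `^ z * expR (- n.+2%:R^-1) - n.+2%:R `^ z * expR (- n.+2%:R))%:E
   + z%:E * \int[leb]_(t in gamma_exhaust n) (gamma_fun z t)%:E)%E); last first.
  apply/funext => n; apply: gamma_fun_by_parts => //.
  by rewrite (@lt_trans _ _ 1)// ?invf_lt1// ltr1n.
rewrite -[X in _ --> X]add0e; apply: cvgeD => //.
- by apply: cvg_EFin; [exact: nearW|exact: cvg_gamma_boundary].
- by apply: cvgeZl.
Qed.

(** t^z e^(-t) <= C e^(-t/2), which is 2 C times the exponential density of rate 1/2. *)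
Lemma egammaS_lty (z : R) : 0 < z -> (egamma (z + 1) < +oo)%E.
Proof.
move=> z0; have [C C0 HC] := powR_le_expR z0.
have i20 : 0 < 2^-1 :> R by rewrite invr_gt0.
apply: (@le_lt_trans _ _ (\int[leb]_t ((C * 2)%:E * (exponential_pdf 2^-1 t)%:E))%E).
  apply: (@le_trans _ _ (\int[leb]_(t in `]0%R, +oo[) ((C * 2)%:E * (exponential_pdf 2^-1 t)%:E))%E).
    apply: ge0_le_integral => //.
    - by move=> t _; rewrite lee_fin gamma_fun_ge0.
    - by apply/measurable_EFinP; exact: measurable_gamma_fun.
    - apply/measurable_EFinP; apply: measurable_funTS.
      apply: measurable_funM => //.
      exact: measurable_exponential_pdf.
    - move=> t; rewrite /= in_itv/= andbT => t0.
      rewrite -EFinM lee_fin exponential_pdfE ?(ltW t0)// /gamma_fun addrK.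
      rewrite (_ : C * 2 * _ = C * expR (t / 2) * expR (- t)).
        by rewrite ler_wpM2r ?expR_ge0 ?HC.
      rewrite -!mulrA -expRD; congr (_ * _); rewrite mulrA divff// mul1r.
      by congr expR; field.
  apply: ge0_subset_integral => //.
  - apply/measurable_EFinP; apply: measurable_funM => //.
    exact: measurable_exponential_pdf.
  - by move=> t _; rewrite -EFinM lee_fin mulr_ge0 ?mulr_ge0// exponential_pdf_ge0// ltW.
rewrite ge0_integralZl//.
- by rewrite integral_exponential_pdf// mule1 ltry.
- by apply/measurable_EFinP; exact: measurable_exponential_pdf.
- by move=> t _; rewrite lee_fin exponential_pdf_ge0// ltW.
- by rewrite lee_fin mulr_ge0.
Qed.

Lemma egamma_gt0 (z : R) : (0 < egamma z)%E.
Proof.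
(* On [1, 2] one has 0 <= ln t <= 2, so t^(z-1) >= e^(-2|z-1|), and e^(-t) >= e^(-2). *)
pose c : R := expR (- (`|z - 1| * 2) - 2).
have : (\int[leb]_(t in `[1%R, 2%R]) c%:E <= egamma z)%E.
  apply: (@le_trans _ _ (\int[leb]_(t in `[1%R, 2%R]) (gamma_fun z t)%:E)%E).
    apply: ge0_le_integral => //.
    - by move=> t _; rewrite lee_fin expR_ge0.
    - by apply/measurable_EFinP; exact: measurable_gamma_fun.
    - move=> t; rewrite /= in_itv/= => /andP[t1 t2].
      have t0 : 0 < t by apply: lt_le_trans t1.
      rewrite lee_fin /gamma_fun /powR gt_eqF// -expRD ler_expR lerB//.
      rewrite lerNl (le_trans (ler_norm _))// normrN normrM ler_wpM2l//.
      by rewrite ger0_norm ?ln_ge0// (le_trans (ltW (ln_sublinear t0))).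
  apply: ge0_subset_integral => //.
  - by apply/measurable_EFinP; exact: measurable_gamma_fun.
  - by move=> t _; rewrite lee_fin gamma_fun_ge0.
  - move=> t /=; rewrite !in_itv/= andbT => /andP[t1 _]; exact: lt_le_trans t1.
apply: lt_le_trans; rewrite integral_cst//= lebesgue_measure_itv/= lte_fin ltr1n/=.
by rewrite -EFinB -EFinM lte_fin mulr_gt0 ?expR_gt0// subr_gt0 ltr1n.
Qed.

(** For z < 1 the integrand is unbounded at 0; finiteness is transferred from z + 1 by the
    functional equation. *)
Lemma egamma_fin_num (z : R) : 0 < z -> egamma z \is a fin_num.
Proof.
move=> z0; rewrite ge0_fin_numE; last exact/ltW/egamma_gt0.
have := egammaS_lty z0; rewrite egammaS//.
case: (egamma z) (egamma_gt0 z) => [r|_|//]; first by rewrite !ltry.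
by rewrite gt0_muley ?lte_fin// ltxx.
Qed.

Lemma GammaE (z : R) : Gamma z = fine (egamma z).
Proof. by []. Qed.

Lemma Gamma_gt0 (z : R) : 0 < z -> 0 < Gamma z.
Proof.
move=> z0; rewrite GammaE fine_gt0// egamma_gt0/= -ge0_fin_numE ?egamma_fin_num//.
exact/ltW/egamma_gt0.
Qed.

Lemma GammaS (z : R) : 0 < z -> Gamma (z + 1) = z * Gamma z.
Proof. by move=> z0; rewrite !GammaE egammaS// fineM// egamma_fin_num. Qed.

Lemma Gamma_pochhammer (b : R) k : 0 < b -> Gamma (b + k%:R) = pochhammer b k * Gamma b.
Proof.
move=> b0; elim: k => [|k IH]; first by rewrite addr0 /pochhammer big_ord0 mul1r.
rewrite -natr1 addrA GammaS ?IH ?pochhammerS; last by rewrite ltr_wpDr.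
by rewrite mulrA mulrC mulrA [Gamma b * _]mulrC; ring.
Qed.

Lemma besselIE (mu y : R) : -1 < mu -> 0 < y ->
  besselI mu y = (y / 2) `^ mu / Gamma (mu + 1) * hyp0F1 (mu + 1) ((y / 2) ^+ 2).
Proof.
move=> mu1 y0; have b0 : 0 < mu + 1 by lra.
have y20 : 0 < y / 2 by rewrite divr_gt0.
rewrite /besselI (_ : (fun k => _) = (fun k => ((y / 2) `^ mu / Gamma (mu + 1))
    * hyp0F1_coeff (mu + 1) ((y / 2) ^+ 2) k)); last first.
  apply/funext => k; rewrite /hyp0F1_coeff.
  rewrite -addrA [k%:R + 1]addrC addrA Gamma_pochhammer//.
  rewrite powRD; last by rewrite (gt_eqF y20) implybT.
  rewrite powR_mulrn ?(ltW y20)// exprM.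
  have := lt0r_neq0 (@pochhammer_gt0 R _ k b0).
  have := lt0r_neq0 (Gamma_gt0 b0).
  have : k`!%:R != 0 :> R by rewrite pnatr_eq0 -lt0n fact_gt0.
  by move=> h1 h2 h3; rewrite /=;  field; rewrite h1 h2 h3.
have h := @is_cvg_series_hyp0F1 R _ ((y / 2) ^+ 2) b0 (exprn_ge0 _ (ltW y20)).
apply/cvg_lim => //; set c := _ / _; rewrite (_ : series _ =
  (fun n => c * series (hyp0F1_coeff (mu + 1) ((y / 2) ^+ 2)) n)).
  by apply: cvgM => //; exact: cvg_cst.
by apply/funext => n; rewrite /series/= mulr_sumr.
Qed.

(** The normalization of rho cancels the factor (y/2)^mu / Gamma(mu + 1) of [I_mu] at y = a
    sqrt(x). *)
Lemma rhoE (mu a x : R) : -1 < mu -> 0 < a -> 0 < x ->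
  rho mu a x = (hyp0F1 (mu + 1) (a ^+ 2 / 4 * x))^-1.
Proof.
move=> mu1 a0 x0; have b0 : 0 < mu + 1 by lra.
have y0 : 0 < a * Num.sqrt x by rewrite mulr_gt0 ?sqrtr_gt0.
rewrite /rho besselIE//; set y := a * _.
rewrite (_ : (y / 2) ^+ 2 = a ^+ 2 / 4 * x); last first.
  by rewrite /y !exprMn sqr_sqrtr ?(ltW x0)//; field.
have -> : y `^ mu = (y / 2) `^ mu * 2 `^ mu.
  by rewrite -powRM ?divr_ge0 ?(ltW y0)// -mulrA mulVf// mulr1.
rewrite !invfM !invrK.
have h1 := lt0r_neq0 (Gamma_gt0 b0).
have h2 : (y / 2) `^ mu != 0 by rewrite gt_eqF// powR_gt0// divr_gt0.
have h3 : 2 `^ mu != 0 :> R by rewrite gt_eqF// powR_gt0.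
set F := (hyp0F1 _ _)^-1; by field; rewrite h1 h2 h3.
Qed.

End gamma_function.

(** * Convolution and distribution functions *)

Section product_probability.
Local Open Scope ereal_scope.
Context d1 d2 (T1 : measurableType d1) (T2 : measurableType d2) (R : realType).
Variables (P : probability T1 R) (Q : probability T2 R).

(** The product measure under a name of its own, to which the probability structure is attached. *)
Definition product_probability : set (T1 * T2) -> \bar R := P \x Q.

HB.instance Definition _ := Measure.on product_probability.

Let product_probability_setT : product_probability setT = 1.
Proof.
rewrite -setXTT; apply: eq_trans (product_measure1E P Q measurableT measurableT) _.
by rewrite [X in X * _](probability_setT P) [X in _ * X](probability_setT Q) mule1.
Qed.

HB.instance Definition _ := Measure_isProbability.Build _ _ _
  product_probability product_probability_setT.

End product_probability.

Section image_probability.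
Context d1 d2 (T1 : measurableType d1) (T2 : measurableType d2) (R : realType).

Definition image_prob (P : probability T1 R) (f : T1 -> T2)
    (mf : measurable_fun setT f) : probability T2 R :=
  distribution P (mfun_Sub (mem_set mf)).

Lemma image_probE (P : probability T1 R) f (mf : measurable_fun setT f) A :
  image_prob P mf A = P (f @^-1` A).
Proof. by []. Qed.

Lemma integral_image_prob (P : probability T1 R) f (mf : measurable_fun setT f)
    (g : T2 -> \bar R) : measurable_fun setT g -> (forall y, 0 <= g y)%E ->
  (\int[image_prob P mf]_y g y = \int[P]_x g (f x))%E.
Proof. by move=> mg g0; rewrite ge0_integral_distribution. Qed.

End image_probability.

Section convolution.
Variable R : realType.
Local Notation T := (measurableTypeR R).
Local Notation PR := (probability T R).
Implicit Types (P Q S : PR) (A : set T).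

Lemma measurable_addp : measurable_fun setT (fun p : T * T => (p.1 + p.2 : T)).
Proof. exact: measurable_funD. Qed.

Lemma measurable_scale (c : R) : measurable_fun setT (fun x : T => (c * x : T)).
Proof. exact: measurable_funM. Qed.

Definition conv P Q : PR := image_prob (product_probability P Q) measurable_addp.

Definition scale (c : R) P : PR := image_prob P (measurable_scale c).

(** Measures are functions on all sets, so the identities between laws are stated on measurable sets
    only. *)
Definition eqlaw P Q := forall A, measurable A -> P A = Q A.

Lemma eqlaw_integral P Q (g : T -> \bar R) : eqlaw P Q ->
  (\int[P]_x g x = \int[Q]_x g x)%E.
Proof. by move=> PQ; apply: eq_measure_integral => A mA _; exact: PQ. Qed.

(** With nonnegative test functions, the algebra of convolutions reduces to Tonelli's theorem. *)
Lemma integral_eqlaw P Q :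
  (forall g : T -> \bar R, measurable_fun setT g -> (forall x, 0 <= g x)%E ->
     \int[P]_x g x = \int[Q]_x g x)%E -> eqlaw P Q.
Proof.
move=> PQ A mA; have := PQ (fun x => (\1_A x)%:E) _ _.
rewrite !integral_indic// !setIT; apply.
  by apply/measurable_EFinP; exact: measurable_indic.
by move=> x; rewrite lee_fin.
Qed.

Section integral_conv.
Local Open Scope ereal_scope.
Variables (g : T -> \bar R) (mg : measurable_fun setT g) (g0 : forall x, 0 <= g x).

Lemma measurable_gadd : measurable_fun setT (fun p : T * T => g (p.1 + p.2)%R).
Proof. by apply: measurableT_comp => //; exact: measurable_addp. Qed.

Lemma measurable_gaddr (x : T) : measurable_fun setT (fun y : T => g (x + y)%R).
Proof. by apply: measurableT_comp => //; exact: measurable_funD. Qed.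

Lemma measurable_int_gadd P : measurable_fun setT (fun x : T => \int[P]_y g (x + y)%R).
Proof. exact: (measurable_fun_fubini_tonelli_F _ measurable_gadd). Qed.

Lemma integral_conv P Q : \int[conv P Q]_z g z = \int[P]_x \int[Q]_y g (x + y)%R.
Proof.
rewrite integral_image_prob//.
by rewrite (@fubini_tonelli1 _ _ _ _ _ P Q _ measurable_gadd).
Qed.

Lemma integral_convC P Q : \int[conv P Q]_z g z = \int[Q]_y \int[P]_x g (x + y)%R.
Proof.
rewrite integral_image_prob//.
by rewrite (@fubini_tonelli2 _ _ _ _ _ P Q _ measurable_gadd).
Qed.

Lemma integral_scale c P : \int[scale c P]_x g x = \int[P]_x g (c * x)%R.
Proof. by rewrite integral_image_prob. Qed.

End integral_conv.

Lemma convC P Q : eqlaw (conv P Q) (conv Q P).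
Proof.
apply: integral_eqlaw => g mg g0; rewrite (integral_conv mg g0) (integral_convC mg g0).
by apply: eq_integral => x _; apply: eq_integral => y _; rewrite addrC.
Qed.

Lemma convA P Q S : eqlaw (conv P (conv Q S)) (conv (conv P Q) S).
Proof.
apply: integral_eqlaw => g mg g0; rewrite (integral_conv mg g0 P).
rewrite (integral_conv mg g0 (conv P Q)).
have h0 x : (0 <= \int[S]_z g (x + z)%R)%E by exact: integral_ge0.
rewrite (integral_conv (measurable_int_gadd mg g0 S) h0).
apply: eq_integral => x _.
rewrite (integral_conv (measurable_gaddr mg x) (fun y => g0 _)).
by apply: eq_integral => y _; apply: eq_integral => z _; rewrite addrA.
Qed.

Lemma conv_eqlaw P P' Q Q' : eqlaw P P' -> eqlaw Q Q' ->
  eqlaw (conv P Q) (conv P' Q').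
Proof.
move=> PP QQ; apply: integral_eqlaw => g mg g0.
rewrite (integral_conv mg g0 P) (integral_conv mg g0 P').
rewrite (eqlaw_integral _ PP); apply: eq_integral => x _.
exact: eqlaw_integral.
Qed.

Lemma scale_eqlaw c P Q : eqlaw P Q -> eqlaw (scale c P) (scale c Q).
Proof.
move=> PQ; apply: integral_eqlaw => g mg g0.
rewrite (integral_scale mg g0 c P) (integral_scale mg g0 c Q).
exact: eqlaw_integral.
Qed.

Lemma scale_conv c P Q : eqlaw (scale c (conv P Q)) (conv (scale c P) (scale c Q)).
Proof.
apply: integral_eqlaw => g mg g0.
have mgc : measurable_fun setT (fun x : T => g (c * x)).
  by apply: measurableT_comp => //; exact: measurable_scale.
rewrite (integral_scale mg g0) (integral_conv mgc (fun x => g0 _)).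
rewrite (integral_conv mg g0).
have h0 x : (0 <= \int[scale c Q]_z g (x + z)%R)%E by exact: integral_ge0.
rewrite (integral_scale (measurable_int_gadd mg g0 _) h0).
apply: eq_integral => x _.
rewrite (integral_scale (measurable_gaddr mg _) (fun y => g0 _)).
by apply: eq_integral => y _; rewrite mulrDr.
Qed.

Lemma eqlaw_trans P Q S : eqlaw P Q -> eqlaw Q S -> eqlaw P S.
Proof. by move=> PQ QS A mA; rewrite PQ// QS. Qed.

Lemma eqlaw_sym P Q : eqlaw P Q -> eqlaw Q P.
Proof. by move=> PQ A mA; rewrite PQ. Qed.

Lemma eqlaw_refl P : eqlaw P P.
Proof. by []. Qed.

Lemma conv_interchange P Q P' Q' :
  eqlaw (conv (conv P Q) (conv P' Q')) (conv (conv P P') (conv Q Q')).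
Proof.
apply: eqlaw_trans (eqlaw_sym (convA _ _ _)) _.
apply: eqlaw_trans _ (convA _ _ _).
apply: conv_eqlaw; first exact: eqlaw_refl.
apply: eqlaw_trans (convA _ _ _) _; apply: eqlaw_trans _ (eqlaw_sym (convA _ _ _)).
by apply: conv_eqlaw; [exact: convC|exact: eqlaw_refl].
Qed.

Definition lawcdf P (t : R) : \bar R := P `]-oo, t]%classic.

End convolution.

(** * Distribution functions of convolutions and their limits *)

Section lawcdf.
Variable R : realType.
Local Notation T := (measurableTypeR R).
Local Notation PR := (probability T R).
Implicit Types (P Q S : PR) (A : set T) (t : R).
Local Open Scope ereal_scope.

Let measurable_idR : measurable_fun setT (fun x : T => (x : R)).
Proof. exact: measurable_id. Qed.

Let cdfE P : lawcdf P = cdf (mfun_Sub (mem_set measurable_idR) : {RV P >-> R}).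
Proof. by []. Qed.

Lemma lawcdf_ge0 P t : 0 <= lawcdf P t.
Proof. exact: measure_ge0. Qed.

Lemma lawcdf_le1 P t : lawcdf P t <= 1.
Proof. exact: probability_le1. Qed.

Lemma lawcdf_fin_num P t : lawcdf P t \is a fin_num.
Proof. exact: fin_num_measure. Qed.

Lemma lawcdf_nd P s t : (s <= t)%R -> lawcdf P s <= lawcdf P t.
Proof. by move=> st; rewrite cdfE; exact: cdf_nondecreasing. Qed.

Lemma lawcdf_right_continuous P : right_continuous (fun t => fine (lawcdf P t)).
Proof.
rewrite cdfE => a; apply: fine_cvg; rewrite fineK; last exact: (lawcdf_fin_num P a).
exact: cdf_right_continuous.
Qed.

Lemma measurable_lawcdf P : measurable_fun setT (lawcdf P).
Proof. by rewrite cdfE; exact: cdf_measurable. Qed.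

Lemma measurable_lawcdfB P t : measurable_fun setT (fun y : T => lawcdf P (t - y)%R).
Proof.
apply: (@measurableT_comp _ _ _ _ _ _ (lawcdf P)); first exact: measurable_lawcdf.
exact: measurable_funB.
Qed.

Lemma lawcdf_inj P Q : lawcdf P =1 lawcdf Q -> eqlaw P Q.
Proof.
move=> PQ A mA.
pose g n : set T := `](- n%:R)%R, (n%:R)%R]%classic.
have cover : \bigcup_n g n = setT by rewrite -(bigcup_itvT false false).
have gE n : (@ocitv R) (g n) by exact: is_ocitv.
have Gm : (@ocitv R) `<=` (measurable : set (set T)) by move=> B [[a b] _ <-].
apply: (@g_sigma_algebra_measure_unique _ R T (@ocitv R) Gm g gE cover P Q) => //.
- exact: ocitvI.
- move=> B [[a b] _ <-] /=.
  have -> : `]a, b]%classic = `]-oo, b] `\` `]-oo, a].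
    by rewrite -[RHS]setCK setCD setCitvl setUC -[LHS]setCK setCitv.
  have [ab|ba] := leP a b; last first.
    rewrite (_ : _ `\` _ = set0) ?measure0//; apply/seteqP; split=> x //=.
    by rewrite !in_itv/= => -[xb]; apply; rewrite (le_trans xb)// ltW.
  have sub : `]-oo, a] `<=` (`]-oo, b]%classic : set R).
    by move=> x; rewrite /= !in_itv/= => /le_trans; apply.
  have mE (P0 : PR) : P0 (`]-oo, b] `\` `]-oo, a]) = lawcdf P0 b - lawcdf P0 a.
    by rewrite measureD ?setIidr// -ge0_fin_numE// fin_num_measure.
  by rewrite !mE !PQ.
- move=> k; apply: le_lt_trans (probability_le1 _ _) (ltry _).
  exact: measurable_itv.
Qed.

Lemma lawcdf_conv P Q t : lawcdf (conv P Q) t = \int[Q]_y lawcdf P (t - y)%R.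
Proof.
pose g (z : T) : \bar R := (\1_(`]-oo, t]%classic : set R) z)%:E.
have mg : measurable_fun setT g by apply/measurable_EFinP; exact: measurable_indic.
have g0 x : 0 <= g x by rewrite lee_fin.
transitivity (\int[conv P Q]_z g z).
  by rewrite integral_indic// setIT.
rewrite (integral_convC mg g0); apply: eq_integral => y _.
transitivity (\int[P]_x (\1_(`]-oo, t - y]%classic : set R) x)%:E).
  apply: eq_integral => x _; rewrite /g !indicE; congr ((_ : bool)%:R)%:E.
  by apply/idP/idP; rewrite !inE/= !in_itv/= lerBrDr.
by rewrite integral_indic// setIT.
Qed.

Lemma lawcdf_convC P Q t : lawcdf (conv P Q) t = \int[P]_y lawcdf Q (t - y)%R.
Proof. by rewrite -lawcdf_conv; apply: convC. Qed.

(** One law is replaced at a time, with the order of integration that puts its distribution function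
    in the integrand. *)
Lemma lawcdf_conv_le P P' Q Q' t :
  (forall s, lawcdf P s <= lawcdf P' s) -> (forall s, lawcdf Q s <= lawcdf Q' s) ->
  lawcdf (conv P Q) t <= lawcdf (conv P' Q') t.
Proof.
move=> PP QQ; apply: (@le_trans _ _ (lawcdf (conv P' Q) t)).
  rewrite !lawcdf_conv; apply: ge0_le_integral => //.
  - exact: measurable_lawcdfB.
  - exact: measurable_lawcdfB.
rewrite !lawcdf_convC; apply: ge0_le_integral => //.
- exact: measurable_lawcdfB.
- exact: measurable_lawcdfB.
Qed.

(** Convergence at every point permits dominated convergence with bound 1, even when [Q] has
    atoms. *)
Lemma cvg_lawcdf_conv (Pn : nat -> PR) P Q t :
  (forall s, lawcdf (Pn n) s @[n --> \oo] --> lawcdf P s) ->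
  lawcdf (conv (Pn n) Q) t @[n --> \oo] --> lawcdf (conv P Q) t.
Proof.
move=> PnP.
have := @dominated_convergence _ _ _ Q setT measurableT
  (fun n y => lawcdf (Pn n) (t - y)%R) (fun y => lawcdf P (t - y)%R) (cst 1).
case=> //.
- by move=> n; exact: measurable_lawcdfB.
- exact: measurable_lawcdfB.
- by apply: aeW => y _; exact: PnP.
- by apply: finite_measure_integrable_cst.
- by apply: aeW => y n _; rewrite gee0_abs ?lawcdf_ge0// lawcdf_le1.
move=> _ _; rewrite lawcdf_conv; apply: cvg_trans.
by under eq_cvg do rewrite lawcdf_conv.
Qed.

(** Both factors vary with n. By monotonicity the limit S lies below conv (Pn n) (Qn m) for all m <=
    n, so n and then m can be sent to infinity separately; the reverse inequality follows from P and
    Q lying below all [Pn] and [Qn]. *)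
Lemma conv_cdf_limit (Pn Qn Sn : nat -> PR) P Q S :
  (forall n s, lawcdf (Pn n.+1) s <= lawcdf (Pn n) s) ->
  (forall n s, lawcdf (Qn n.+1) s <= lawcdf (Qn n) s) ->
  (forall n, eqlaw (conv (Pn n) (Qn n)) (Sn n)) ->
  (forall s, lawcdf (Pn n) s @[n --> \oo] --> lawcdf P s) ->
  (forall s, lawcdf (Qn n) s @[n --> \oo] --> lawcdf Q s) ->
  (forall s, lawcdf (Sn n) s @[n --> \oo] --> lawcdf S s) ->
  eqlaw (conv P Q) S.
Proof.
move=> ndP ndQ PQS cP cQ cS; apply: lawcdf_inj => t.
have mono (F : nat -> PR) : (forall n s, lawcdf (F n.+1) s <= lawcdf (F n) s) ->
    forall m n s, (m <= n)%N -> lawcdf (F n) s <= lawcdf (F m) s.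
  move=> ndF m n s; elim: n => [|n IH]; first by rewrite leqn0 => /eqP ->.
  rewrite leq_eqVlt => /orP[/eqP->//|]; rewrite ltnS => /IH; exact: le_trans.
have lim_le (F : nat -> PR) G : (forall n s, lawcdf (F n.+1) s <= lawcdf (F n) s) ->
    (forall s, lawcdf (F n) s @[n --> \oo] --> lawcdf G s) ->
    forall n s, lawcdf G s <= lawcdf (F n) s.
  move=> ndF cF n s; apply: (cvge_to_le (cF s)).
  by exists n => // m /= nm; exact: mono.
apply/eqP; rewrite eq_le; apply/andP; split.
  apply: (cvge_to_ge (cS t)); apply: nearW => n; rewrite -[leRHS](PQS n)//.
  by apply: lawcdf_conv_le; exact: lim_le.
have le1 m : lawcdf S t <= lawcdf (conv P (Qn m)) t.
  have c1 := @cvg_lawcdf_conv Pn P (Qn m) t cP.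
  apply: (cvge_to_ge c1).
  exists m => // n /= mn; apply: (cvge_to_le (cS t)).
  exists n => // k /= nk; rewrite -[leLHS](PQS k)//.
  by apply: lawcdf_conv_le => s; apply: mono => //; exact: leq_trans nk.
have := @cvg_lawcdf_conv Qn Q P t cQ.
rewrite [lawcdf _ _]convC// => /cvge_to_ge; apply; apply: nearW => n.
by rewrite [leRHS]convC//; exact: le1.
Qed.

(** This form of nonnegativity passes to pointwise limits of distribution functions; [nonneg_on]
    recovers [on_nonneg]. *)
Definition nonneg P := forall t, (t < 0)%R -> lawcdf P t = 0.

Lemma nonneg_itv P : nonneg P -> P `]-oo, 0%R[%classic = 0.
Proof.
move=> P0; apply/eqP; rewrite eq_le measure_ge0 andbT.
have -> : `]-oo, 0%R[%classic = \bigcup_n `]-oo, (- n.+1%:R^-1)%R]%classic :> set R.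
  apply/seteqP; split=> x /=; rewrite in_itv/=.
    move=> x0; have [n xn] : exists n, ((- x)^-1 < n.+1%:R)%R.
      by exists (Num.truncn (- x)^-1); exact: truncnS_gt.
    exists n => //=; rewrite in_itv/= lerNr.
    by rewrite -[leRHS]invrK lef_pV2 ?posrE ?invr_gt0 ?oppr_gt0// ltW.
  by move=> [n _]; rewrite /= in_itv/= => /le_lt_trans; apply; rewrite oppr_lt0 invr_gt0.
apply: (@le_trans _ _ (\sum_(n <oo) P `]-oo, (- n.+1%:R^-1)%R]%classic)).
  by apply: measure_sigma_subadditive => //; exact: bigcup_measurable.
rewrite eseries0// => n _ _; apply: P0.
by rewrite oppr_lt0 invr_gt0.
Qed.

Lemma nonneg_ae P : nonneg P -> {ae P, forall x : T, (0 <= x)%R}.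
Proof.
move=> P0; exists `]-oo, 0%R[%classic; split => //; first exact: nonneg_itv.
by move=> x /= /negP; rewrite in_itv/= -ltNge.
Qed.

Lemma nonneg_on P : nonneg P -> on_nonneg P.
Proof.
move=> P0; rewrite /on_nonneg -(probability_setT P).
rewrite -(setUv `[0%R, +oo[%classic) measureU//; last by rewrite setICr.
  by rewrite setCitvr [X in _ + X]nonneg_itv// adde0.
exact: measurableC.
Qed.

(** X + Y <= t forces X <= t when Y >= 0. This is the source of all the monotonicity in n. *)
Lemma lawcdf_conv_nonneg P Q t : nonneg Q -> lawcdf (conv P Q) t <= lawcdf P t.
Proof.
move=> Q0; rewrite lawcdf_conv.
apply: (@le_trans _ _ (\int[Q]_y (cst (lawcdf P t) y))).
  apply: ae_ge0_le_integral => //.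
  - exact: measurable_lawcdfB.
  - apply: filterS (nonneg_ae Q0) => y y0 _; apply: lawcdf_nd.
    by rewrite gerBl.
by rewrite integral_cst// [X in _ * X](probability_setT Q) mule1.
Qed.

Lemma nonneg_conv P Q : nonneg P -> nonneg Q -> nonneg (conv P Q).
Proof.
move=> P0 Q0 t t0; apply/eqP; rewrite eq_le lawcdf_ge0 andbT -(P0 t t0).
exact: lawcdf_conv_nonneg.
Qed.

Lemma nonneg_image (P : PR) (f : T -> T) (mf : measurable_fun setT f) :
  nonneg P -> (forall x : R, (0 <= x)%R -> (0 <= f x :> R)%R) -> nonneg (image_prob P mf).
Proof.
move=> P0 f0 t t0; apply/eqP; rewrite eq_le lawcdf_ge0 andbT -(nonneg_itv P0).
rewrite /lawcdf image_probE; apply: le_measure; rewrite ?inE//.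
  by rewrite -[X in measurable X]setTI; exact: mf.
move=> x /=; rewrite !in_itv/= => fx; rewrite ltNge; apply/negP => /f0.
by move=> fx0; have := le_lt_trans (le_trans fx0 fx) t0; rewrite ltxx.
Qed.

Lemma nonneg_lim (Pn : nat -> PR) P : (forall n, nonneg (Pn n)) ->
  (forall s, lawcdf (Pn n) s @[n --> \oo] --> lawcdf P s) -> nonneg P.
Proof.
move=> Pn0 cP t t0; apply/eqP; rewrite eq_le lawcdf_ge0 andbT.
by apply: (cvge_to_le (cP t)); apply: nearW => n; rewrite Pn0.
Qed.

End lawcdf.

(** * Decreasing limits of distribution functions *)

Section cdf_limit.
Variable R : realType.
Local Notation T := (measurableTypeR R).
Local Notation PR := (probability T R).

Lemma cumulative_law (F : R -> R) : nondecreasing F -> right_continuous F ->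
  F @ -oo --> (0 : R) -> F @ +oo --> (1 : R) ->
  exists P : PR, forall t, lawcdf P t = (F t)%:E.
Proof.
move=> nd rc c0 c1.
pose m1 := isCumulative.Build R _ R F nd rc.
pose m2 := isCumulativeBounded.Build R 0 1 F c0 c1.
pose f : cumulativeBounded (0:R) (1:R) := HB.pack F m1 m2.
exists (lebesgue_stieltjes_measure f) => t.
exact: (cdf_lebesgue_stieltjes_id f t).
Qed.

(** The infimum of the distribution functions is the candidate. Its limit at -oo comes from
    nonnegativity, its limit at +oo from tightness. *)
Lemma cdf_limit_exists (Pn : nat -> PR) :
  (forall n s, (lawcdf (Pn n.+1) s <= lawcdf (Pn n) s)%E) ->
  (forall n, nonneg (Pn n)) ->
  (forall e, 0 < e -> exists t, forall n, ((1 - e)%:E <= lawcdf (Pn n) t)%E) ->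
  exists P : PR, forall s, lawcdf (Pn n) s @[n --> \oo] --> lawcdf P s.
Proof.
move=> nd Pn0 tight; pose f n t := fine (lawcdf (Pn n) t).
have fE n t : (f n t)%:E = lawcdf (Pn n) t by rewrite fineK// lawcdf_fin_num.
have f0 n t : 0 <= f n t by rewrite -lee_fin fE lawcdf_ge0.
have f1 n t : f n t <= 1 by rewrite -lee_fin fE lawcdf_le1.
have fnd n s t : s <= t -> f n s <= f n t.
  by move=> st; rewrite -lee_fin !fE lawcdf_nd.
have fS t : nonincreasing_seq (fun n => f n t).
  by apply/nonincreasing_seqP => n; rewrite -lee_fin !fE.
have lb t : has_lbound (range (fun n => f n t)) by exists 0 => _ [n _ <-].
have hinf t : has_inf (range (fun n => f n t)).
  by split => //; exists (f 0%N t); exists 0%N.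
pose F t := inf (range (fun n => f n t)).
have Ff n t : F t <= f n t by apply: ge_inf => //; exists n.
have Fge t x : (forall n, x <= f n t) -> x <= F t.
  by move=> xf; apply: lb_le_inf; [exact: (hinf t).1|move=> _ [n _ <-]].
have Fnd : nondecreasing F.
  by move=> s t st; apply: Fge => n; exact: le_trans (Ff n s) (fnd n _ _ st).
have [P PF] : exists P : PR, forall t, lawcdf P t = (F t)%:E.
  apply: cumulative_law => //.
  - move=> x; apply/cvgrPdist_lt => e e0.
    (* Right continuity survives an infimum: near x from the right, F stays below a single [f n]
       chosen with f n x < F x + e. *)
    have [_ [n _ <-] fn] := inf_adherent e0 (hinf x).
    have fc : f n y @[y --> x^'+] --> f n x by exact: lawcdf_right_continuous.
    near=> y.
    have Fxy : F x <= F y by apply: Fnd; near: y; exact: nbhs_right_ge.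
    rewrite distrC ger0_norm ?subr_ge0// ltrBlDl.
    apply: (le_lt_trans (Ff n y)).
    by near: y; apply: (cvgr_lt (f n x)) => //.
  - suff H : \forall t \near -oo, F t = 0 by exact: (@cvg_near_cst _ _ 0 F _ _ H).
    apply: filterS (nbhs_ninfty_lt (num_real 0)) => t t0; apply/eqP; rewrite eq_le; apply/andP; split; last exact: Fge.
    by apply: (le_trans (Ff 0%N t)); rewrite -lee_fin fE Pn0.
  - apply/cvgrPdist_le => e e0; have [t0 Ht0] := tight e e0.
    apply: filterS (nbhs_pinfty_ge (num_real t0)) => t tt0.
    have F1 : F t <= 1 by apply: le_trans (Ff 0%N t) _.
    rewrite ger0_norm ?subr_ge0// lerBlDr -lerBlDl; apply: Fge => n.
    apply: (@le_trans _ _ (f n t0)); first by rewrite -lee_fin fE.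
    exact: fnd.
exists P => s; rewrite PF; apply: cvg_EFin.
  by apply: nearW => n; exact: lawcdf_fin_num.
exact: (nonincreasing_cvgn (fS s) (lb s)).
Unshelve. all: by end_near. Qed.

End cdf_limit.

(** * The exponential law *)

Section exponential_law.
Variable R : realType.
Local Notation T := (measurableTypeR R).
Local Notation PR := (probability T R).
Local Notation leb := (@lebesgue_measure R).
Local Notation pdf := (@exponential_pdf R).

Definition exp_law : PR :=
  exponential_distribution_exponential_prob__canonical__probability_measure_Probability
    (@ltr01 R).

Lemma exp_lawE (A : set T) : exp_law A = (\int[leb]_(x in A) (pdf 1 x)%:E)%E.
Proof. by []. Qed.

Lemma measurable_pdf r : measurable_fun setT (fun x : T => (pdf r x)%:E).
Proof. by apply/measurable_EFinP; exact: measurable_exponential_pdf. Qed.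

Lemma exp_law_dom : exp_law `<< leb.
Proof.
apply/null_content_dominatesP => A mA A0; rewrite exp_lawE.
by apply: null_set_integral => //; apply: measurable_funTS; exact: measurable_pdf.
Qed.

Lemma integral_exp_law (f : T -> \bar R) : exp_law.-integrable setT f ->
  (\int[exp_law]_x f x = \int[leb]_x (f x * (pdf 1 x)%:E))%E.
Proof.
move=> intf; have mf : measurable_fun setT f by exact: measurable_int intf.
rewrite -(Radon_Nikodym_change_of_variables exp_law_dom)//=.
apply: ae_eq_integral => //.
- apply: emeasurable_funM => //; apply: (measurable_int leb).
  by apply: Radon_Nikodym_integrable; exact: exp_law_dom.
- by apply: emeasurable_funM => //; exact: measurable_pdf.
- apply: ae_eqe_mul2l => /=.
  rewrite Radon_NikodymE//=; first exact: exp_law_dom.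
  move=> abmu; case: cid => /= h [h1 h2 h3].
  apply: integral_ae_eq => //=.
  + exact: measurable_pdf.
  + by move=> E _ mE; rewrite -h3.
Qed.

Lemma exp_law_null (x : R) : exp_law [set x] = 0%E.
Proof. by rewrite exp_lawE integral_set1. Qed.

Lemma exp_law_lt0 (t : R) : t < 0 -> exp_law `]-oo, t]%classic = 0%E.
Proof.
move=> t0; rewrite exp_lawE; apply: integral0_eq => x /=.
by rewrite in_itv/= => xt; rewrite lt0_exponential_pdf// (le_lt_trans xt).
Qed.

Lemma exp_law_nonneg : nonneg exp_law.
Proof. by move=> t t0; exact: exp_law_lt0. Qed.

Lemma exp_law_cdf (t : R) : 0 <= t -> lawcdf exp_law t = (1 - expR (- t))%:E.
Proof.
move=> t0; rewrite /lawcdf.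
have -> : `]-oo, t]%classic = `]-oo, 0[%classic `|` `[0, t]%classic :> set R.
  apply/seteqP; split=> x /=; rewrite !in_itv/=.
    by move=> ->; have [x0|x0] := ltP x 0; [left|right].
  by move=> [/ltW/le_trans->//|/andP[]].
rewrite measureU//; last first.
  apply/seteqP; split=> x //=; rewrite !in_itv/= => -[x0 /andP[x1 _]].
  by move: x0; rewrite ltNge x1.
rewrite [X in (X + _)%E](nonneg_itv exp_law_nonneg) add0e.
move: t0; rewrite le_eqVlt => /orP[/eqP <-|t0].
  by rewrite set_itv1 [LHS]exp_law_null oppr0 expR0 subrr.
by rewrite [LHS]exponential_prob_itv0c// mulN1r.
Qed.

Lemma exp_law_tail (v : R) : 0 <= v -> exp_law `[v, +oo[%classic = (expR (- v))%:E.
Proof.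
move=> v0.
have -> : `[v, +oo[%classic = [set v] `|` `]v, +oo[%classic :> set R.
  apply/seteqP; split=> x /=; rewrite !in_itv/= !andbT.
    by rewrite le_eqVlt => /orP[/eqP->|]; [left|right].
  by move=> [->//|/ltW].
rewrite measureU//; last first.
  by apply/seteqP; split=> x //=; rewrite in_itv/= andbT => -[->]; rewrite ltxx.
rewrite [X in (X + _)%E]exp_law_null add0e.
rewrite -setCitvl; have := probability_setC exp_law (measurable_itv `]-oo, v]).
move=> h; apply: (eq_trans h); rewrite -[X in (_ - X)%E]/(lawcdf exp_law v).
by rewrite exp_law_cdf// -EFinB; congr EFin; ring.
Qed.

Lemma bounded_integrable (P : PR) (f : T -> R) (M : R) : measurable_fun setT f ->
  (forall x, `|f x| <= M) -> P.-integrable setT (EFin \o f).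
Proof.
move=> mf fM; apply: (@le_integrable _ _ _ _ _ _ _ (cst M%:E)) => //.
- exact/measurable_EFinP.
- by move=> x _ /=; rewrite lee_fin (le_trans (fM x))// ler_norm.
- exact: finite_measure_integrable_cst.
Qed.

Lemma exp_law_laplace (y : R) : 0 <= y ->
  (\int[exp_law]_u (expR (- (y * u)))%:E = ((1 + y)^-1)%:E)%E.
Proof.
move=> y0.
have mexp : measurable_fun setT (fun u : T => expR (- (y * u)) : R).
  apply: measurableT_comp => //; apply: measurable_funN; exact: measurable_funM.
(* The absolute value changes nothing almost surely and makes the integrand bounded on the whole
   line. *)
transitivity (\int[exp_law]_u (expR (- (y * `|u|)))%:E)%E.
  apply: ge0_ae_eq_integral => //.
  - exact/measurable_EFinP.
  - apply/measurable_EFinP; apply: measurableT_comp => //; apply: measurable_funN.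
    by apply: measurable_funM => //; exact: measurable_normr.
  - apply: filterS (nonneg_ae exp_law_nonneg) => u u0 _.
    by rewrite ger0_norm.
rewrite integral_exp_law; last first.
  apply: (@bounded_integrable _ (fun u => expR (- (y * `|u|))) 1).
    apply: measurableT_comp => //; apply: measurable_funN.
    by apply: measurable_funM => //; exact: measurable_normr.
  move=> u; rewrite ger0_norm ?expR_ge0// -[leRHS](@expR0 R) ler_expR.
  by rewrite oppr_le0 mulr_ge0.
have y1 : 0 < 1 + y by lra.
transitivity (((1 + y)^-1)%:E * \int[leb]_u (pdf (1 + y) u)%:E)%E; last first.
  by rewrite integral_exponential_pdf// mule1.
have pdf0 (u : T) : setT u -> (0 <= (pdf (1 + y) u)%:E)%E.
  by move=> _; rewrite lee_fin exponential_pdf_ge0// ltW.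
have i0 : (0 <= ((1 + y)^-1)%:E :> \bar R)%E by rewrite lee_fin invr_ge0 ltW.
rewrite -(ge0_integralZl leb measurableT (measurable_pdf (1 + y)) pdf0 i0).
apply: eq_integral => u _; rewrite -!EFinM; congr EFin.
have [u0|u0] := ltP u 0; first by rewrite !lt0_exponential_pdf// !mulr0.
rewrite !exponential_pdfE// ger0_norm// mul1r mulrA mulVf ?gt_eqF// mul1r -expRD.
by congr expR; ring.
Qed.

Lemma measurable_shift_max (d l : R) :
  measurable_fun setT (fun u : T => (l * Num.max (u - d) 0 : T)).
Proof.
apply: measurable_funM => //; apply: measurable_maxr => //.
exact: measurable_funB.
Qed.

(* For [d = - ln (1 - c)], memorylessness of the exponential law makes this the
   mixture [c delta_0 + (1 - c) Exp] scaled by [l]. *)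
Definition thinned_law (d l : R) : PR := image_prob exp_law (measurable_shift_max d l).

Lemma thinned_law_cdf (d s : R) : 0 <= d ->
  lawcdf (thinned_law d 1) s = if 0 <= s then (1 - expR (- d) * expR (- s))%:E else 0%E.
Proof.
move=> d0; rewrite /lawcdf image_probE; case: ifPn => s0.
  transitivity (lawcdf exp_law (s + d)).
    congr (exp_law _); apply/seteqP; split => u; rewrite /= !in_itv/= mul1r ge_max.
      by move=> /andP[]; rewrite lerBlDr.
    by rewrite s0 andbT lerBlDr.
  by rewrite exp_law_cdf ?addr_ge0// opprD expRD mulrC.
rewrite (_ : _ @^-1` _ = set0) ?measure0//.
apply/seteqP; split=> u //=; rewrite in_itv/= mul1r ge_max => /andP[_].
by rewrite (negbTE s0).
Qed.

(** The left side is the distribution function at t of the thinned variable plus c E, conditioned on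
    E = u. The antiderivative [G] vanishes at t / c, where both of its terms equal e^(-t/c). *)
Lemma thinned_integral (c t : R) : 0 < c < 1 -> 0 <= t ->
  (\int[leb]_(u in `[0%R, (t / c)%R]) (expR (- u) - (1 - c) * expR (- t) * expR (- ((1 - c) * u)))%:E
   = (1 - expR (- t))%:E)%E.
Proof.
move=> /andP[c0 c1]; rewrite le_eqVlt => /orP[/eqP <-|t0].
  by rewrite mul0r set_itv1 integral_set1 oppr0 expR0 subrr.
pose G (u : R) : R := expR (- t) * expR (- ((1 - c) * u)) - expR (- u).
pose g (u : R) : R := expR (- u) - (1 - c) * expR (- t) * expR (- ((1 - c) * u)).
have cE (k : R) u : {for u, continuous (fun u : R => expR (- (k * u)))}.
  apply: continuous_comp; last exact: continuous_expR.
  by apply: cvgN; apply: cvgM; [exact: cvg_cst|exact: cvg_id].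
have cE1 (u : R) : {for u, continuous (fun u : R => expR (- u))}.
  by apply: continuous_comp; [exact: opp_continuous|exact: continuous_expR].
have dE (k u : R) : is_derive u 1 (fun u : R => expR (- (k * u))) (- k * expR (- (k * u))).
  have h : is_derive u 1 (fun u : R => - (k * u)) (- (k *: 1)).
    apply: is_deriveN; exact: is_deriveZ.
  have := @is_derive1_comp R expR (fun u : R => - (k * u)) u _ _ _ h.
  by move=> /(_ _ (is_derive_expR _)); rewrite /comp /= [- _ * _]mulrC /GRing.scale/= mulr1.
have dG (u : R) : is_derive u 1 G (g u).
  have h1 := dE 1 u; have h2 := is_deriveZ (expR (- t)) (dE (1 - c) u).
  have := is_deriveB h2 h1.
  rewrite (_ : _ - _ = G :> (R -> R)); last first.
    by apply/funext => v; rewrite /G !fctE mul1r.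
  rewrite (_ : _ - _ = g u)//.
  by rewrite /g /GRing.scale/= !mul1r; ring.
have cG (u : R) : {for u, continuous G}.
  by apply: differentiable_continuous; apply/derivable1_diffP; have [] := dG u.
have tc : 0 < t / c by rewrite divr_gt0.
rewrite (@continuous_FTC2 R g G 0 (t / c) tc).
- rewrite -EFinB; congr EFin; rewrite /G !mulr0 !oppr0 expR0 mulr1 -expRD.
  have -> : - t + - ((1 - c) * (t / c)) = - (t / c) by field; rewrite gt_eqF.
  by ring.
- apply: continuous_subspaceT => u; apply: cvgB; first exact: cE1.
  by apply: cvgM; [exact: cvg_cst|exact: cE].
- split.
  + by move=> u _; have [] := dG u.
  + by apply: cvg_at_right_filter; exact: cG.
  + by apply: cvg_at_left_filter; exact: cG.
- by move=> u _; rewrite derive1E; have h := dG u; rewrite derive_val.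
Qed.

(** In Laplace transforms: (c + (1 - c) / (1 + s)) / (1 + c s) = 1 / (1 + s). The verification is
    carried out on distribution functions. *)
Lemma thinned_conv1 (c : R) : 0 < c < 1 ->
  eqlaw (conv (thinned_law (- ln (1 - c)) 1) (scale c exp_law)) exp_law.
Proof.
move=> /andP[c0 c1]; set d := - ln (1 - c); apply: lawcdf_inj => t.
have oc0 : 0 < 1 - c by rewrite subr_gt0.
have d0 : 0 <= d by rewrite oppr_ge0 ln_le0// gerBl ltW.
have dE : expR (- d) = 1 - c by rewrite opprK lnK.
have nnT : nonneg (thinned_law d 1).
  apply: nonneg_image; first exact: exp_law_nonneg.
  by move=> u _; rewrite mul1r le_max lexx orbT.
have nnS : nonneg (scale c exp_law).
  apply: nonneg_image; first exact: exp_law_nonneg.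
  by move=> u u0; rewrite mulr_ge0// ltW.
have [t0|] := ltP t 0; first by rewrite (nonneg_conv nnT nnS t0) exp_law_nonneg.
move=> t0; rewrite exp_law_cdf// -(@thinned_integral c t) ?c0//.
rewrite lawcdf_conv (integral_scale (measurable_lawcdfB _ _) (fun y => lawcdf_ge0 _ _)).
pose h (u : R) : R := if c * u <= t then 1 - (1 - c) * expR (- (t - c * u)) else 0.
have hE u : lawcdf (thinned_law d 1) (t - c * u) = (h u)%:E.
  by rewrite thinned_law_cdf// dE /h subr_ge0; case: ifP.
have mh : measurable_fun setT (fun u : T => (h u)%:E).
  under eq_fun do rewrite -hE.
  apply: measurableT_comp; first exact: measurable_lawcdf.
  by apply: measurable_funB => //; exact: measurable_funM.
transitivity (\int[exp_law]_u (h u)%:E)%E.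
  by apply: eq_integral => u _; rewrite hE.
rewrite integral_exp_law; last first.
  apply: (@bounded_integrable _ _ 1); first exact/measurable_EFinP.
  have h0 u : 0 <= h u by rewrite -lee_fin -hE lawcdf_ge0.
  by move=> u; rewrite ger0_norm// -lee_fin -hE lawcdf_le1.
rewrite [RHS]integral_mkcond/=; apply: eq_integral => u _.
have cu : (c * u <= t) = (u <= t / c) by rewrite ler_pdivlMr// mulrC.
rewrite patchE -EFinM; case: ifPn; rewrite /h.
  rewrite inE/= in_itv/= => /andP[u0 utc].
  rewrite cu utc exponential_pdfE// mul1r mulN1r.
  congr EFin; rewrite mulrBl mul1r -!mulrA -!expRD.
  by congr (_ - _ * expR _); ring.
rewrite notin_setE/= in_itv/= => /negP; rewrite negb_and -!ltNge => /orP[u0|utc].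
  by rewrite lt0_exponential_pdf// mulr0.
by rewrite cu leNgt utc/= mul0r.
Qed.

Lemma thinned_conv (c l : R) : 0 < c < 1 ->
  eqlaw (conv (thinned_law (- ln (1 - c)) l) (scale c (scale l exp_law)))
        (scale l exp_law).
Proof.
move=> c01; set d := - ln (1 - c).
apply: eqlaw_trans (scale_eqlaw l (thinned_conv1 c01)).
apply: eqlaw_trans _ (eqlaw_sym (scale_conv _ _ _)).
apply: conv_eqlaw => A mA.
- rewrite /scale /thinned_law !image_probE; congr (exp_law _).
  by apply/seteqP; split => u; rewrite /= mul1r.
- rewrite /scale !image_probE; congr (exp_law _).
  by apply/seteqP; split => u; rewrite /= mulrCA.
Qed.

End exponential_law.

(** * Laplace transforms and infinite convolutions *)

Section laplace_transform.
Variable R : realType.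
Local Notation T := (measurableTypeR R).
Local Notation PR := (probability T R).
Implicit Types (P Q : PR) (x : R).
Local Open Scope ereal_scope.

(** Extended values and the whole line as domain let Tonelli apply directly; [laplaceE] links it to
    [laplace]. *)
Definition elaplace P x := \int[P]_t (expR (- (x * t)))%:E.

Lemma measurable_expRM x : measurable_fun setT (fun t : T => (expR (- (x * t)))%:E).
Proof.
apply/measurable_EFinP; apply: measurableT_comp => //.
by apply: measurable_funN; exact: measurable_funM.
Qed.

Lemma elaplace_ge0 P x : 0 <= elaplace P x.
Proof. by apply: integral_ge0 => t _; rewrite lee_fin expR_ge0. Qed.

Lemma elaplace_conv P Q x : elaplace (conv P Q) x = elaplace P x * elaplace Q x.
Proof.
have pos (t : T) : 0 <= (expR (- (x * t)))%:E by rewrite lee_fin expR_ge0.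
rewrite /elaplace (integral_conv (measurable_expRM x) pos).
transitivity (\int[P]_s ((expR (- (x * s)))%:E * elaplace Q x)).
  apply: eq_integral => s _.
  rewrite -(ge0_integralZl Q measurableT (measurable_expRM x) (fun t _ => pos t) (pos s)).
  by apply: eq_integral => t _; rewrite -EFinM -expRD; congr (expR _)%:E; ring.
rewrite (ge0_integralZr P measurableT (measurable_expRM x) (fun t _ => pos t))//.
exact: elaplace_ge0.
Qed.

Lemma elaplace_scale_exp (l x : R) : (0 <= l)%R -> (0 <= x)%R ->
  elaplace (scale l (exp_law R)) x = ((1 + l * x)^-1)%:E.
Proof.
move=> l0 x0; rewrite -(exp_law_laplace (mulr_ge0 l0 x0)).
rewrite /elaplace (integral_scale (measurable_expRM x)); last first.
  by move=> t; rewrite lee_fin expR_ge0.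
by apply: eq_integral => t _; rewrite mulrCA mulrA.
Qed.

Lemma elaplace_nonneg P x : nonneg P ->
  elaplace P x = \int[P]_(t in `[0%R, +oo[) (expR (- (x * t)))%:E.
Proof.
move=> P0; rewrite /elaplace [RHS]integral_mkcond.
apply: ge0_ae_eq_integral => //.
- exact: measurable_expRM.
- by apply/(measurable_restrictT _ _).1 => //; exact: measurable_funTS (measurable_expRM x).
- by move=> t _; apply: erestrict_ge0 => u _; rewrite lee_fin expR_ge0.
- apply: filterS (nonneg_ae P0) => t t0 _.
  by rewrite patchE ifT// inE/= in_itv/= t0.
Qed.

Lemma laplaceE P x : nonneg P -> laplace P x = fine (elaplace P x).
Proof. by move=> P0; rewrite elaplace_nonneg. Qed.

(* e^(-xs) is the probability that an exponential variable exceeds xs. *)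
Lemma elaplace_cdf P x : nonneg P -> (0 < x)%R ->
  elaplace P x = lawcdf (conv P (scale (- x^-1) (exp_law R))) 0.
Proof.
move=> P0 x0; rewrite lawcdf_convC; apply: ge0_ae_eq_integral => //.
- exact: measurable_expRM.
- exact: measurable_lawcdfB.
- apply: filterS (nonneg_ae P0) => s s0 _.
  rewrite -exp_law_tail ?mulr_ge0 ?(ltW x0)// /lawcdf image_probE sub0r.
  congr (exp_law R _); apply/seteqP; split => u; rewrite /= !in_itv/= ?andbT.
    by move=> h; rewrite mulNr lerN2 ler_pdivlMl.
  by rewrite mulNr lerN2 ler_pdivlMl.
Qed.

Lemma elaplace_fin_num P x : nonneg P -> (0 < x)%R -> elaplace P x \is a fin_num.
Proof. by move=> P0 x0; rewrite elaplace_cdf// lawcdf_fin_num. Qed.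

(** By [elaplace_cdf] this is an instance of the convergence of distribution functions of
    convolutions. *)
Lemma cvg_elaplace (Pn : nat -> PR) P x : (forall n, nonneg (Pn n)) ->
  (forall s, lawcdf (Pn n) s @[n --> \oo] --> lawcdf P s) -> (0 < x)%R ->
  elaplace (Pn n) x @[n --> \oo] --> elaplace P x.
Proof.
move=> Pn0 cP x0; rewrite elaplace_cdf//; last exact: nonneg_lim cP.
have := @cvg_lawcdf_conv R Pn P (scale (- x^-1) (exp_law R)) 0 cP.
by apply: cvg_trans; apply: near_eq_cvg; apply: nearW => n; rewrite elaplace_cdf.
Qed.

(** For s >= 0, e^(-xs) is at most 1 when s <= t and at most e^(-xt) otherwise. A Laplace transform
    near 1 thus forces mass below t, which yields tightness. *)
Lemma elaplace_tail P x (t : R) : nonneg P -> (0 < x)%R ->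
  elaplace P x <= lawcdf P t + (expR (- (x * t)))%:E.
Proof.
move=> P0 x0.
have -> : lawcdf P t + (expR (- (x * t)))%:E =
    \int[P]_s ((\1_(`]-oo, t]%classic : set R) s)%:E + (expR (- (x * t)))%:E).
  rewrite ge0_integralD//.
  - by rewrite integral_indic// setIT integral_cst// [X in _ + _ * X](probability_setT P) mule1.
  - by apply/measurable_EFinP; exact: measurable_indic.
apply: ae_ge0_le_integral => //.
- exact: measurable_expRM.
- by move=> s _; rewrite adde_ge0// lee_fin// expR_ge0.
- by apply: emeasurable_funD => //; apply/measurable_EFinP; exact: measurable_indic.
- apply: filterS (nonneg_ae P0) => s s0 _; rewrite -EFinD lee_fin indicE.
  case: (boolP (s \in _)) => [_|]; last first.
    rewrite notin_setE/= in_itv/= => /negP; rewrite -ltNge add0r ler_expR lerN2 => ts.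
    by rewrite ler_wpM2l// ltW.
  rewrite ler_wpDr ?expR_ge0// -[leRHS](@expR0 R) ler_expR oppr_le0.
  by rewrite mulr_ge0// ltW.
Qed.

Definition dirac_law (a : R) : PR := @dirac _ T a R.

Lemma integral_dirac_law (a : R) (f : T -> \bar R) : measurable_fun setT f ->
  \int[dirac_law a]_x f x = f a.
Proof. by move=> mf; rewrite integral_dirac// diracT mul1e. Qed.

Lemma elaplace_dirac (a x : R) : elaplace (dirac_law a) x = (expR (- (x * a)))%:E.
Proof. by rewrite /elaplace integral_dirac_law//; exact: measurable_expRM. Qed.

Lemma nonneg_dirac (a : R) : (0 <= a)%R -> nonneg (dirac_law a).
Proof.
move=> a0 t t0; rewrite /lawcdf /= diracE memNset//= in_itv/=.
by move=> /(le_trans a0) /le_lt_trans/(_ t0); rewrite ltxx.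
Qed.

Lemma scale_dirac (c a : R) : eqlaw (scale c (dirac_law a)) (dirac_law (c * a)).
Proof.
apply: integral_eqlaw => g mg g0; rewrite (integral_scale mg g0) !integral_dirac_law//.
by apply: measurableT_comp => //; exact: measurable_scale.
Qed.

Lemma conv_dirac (a b : R) : eqlaw (conv (dirac_law a) (dirac_law b)) (dirac_law (a + b)).
Proof.
apply: integral_eqlaw => g mg g0; rewrite (integral_conv mg g0).
rewrite integral_dirac_law; last exact: measurable_int_gadd.
by rewrite !integral_dirac_law//; exact: measurable_gaddr.
Qed.

Lemma lawcdf_scale (c t : R) P : (0 < c)%R -> lawcdf (scale c P) t = lawcdf P (t / c).
Proof.
move=> c0; rewrite /lawcdf image_probE; congr (P _).
by apply/seteqP; split => x; rewrite /= !in_itv/= ler_pdivlMr// mulrC.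
Qed.

End laplace_transform.

(** * Infinite convolutions and self-decomposability *)

Section infinite_convolution.
Variable R : realType.
Local Notation T := (measurableTypeR R).
Local Notation PR := (probability T R).

Fixpoint conv_seq (P : PR) (Q : nat -> PR) n : PR :=
  if n is m.+1 then conv (conv_seq P Q m) (Q m) else P.

Lemma nonneg_conv_seq P Q n : nonneg P -> (forall i, nonneg (Q i)) ->
  nonneg (conv_seq P Q n).
Proof. by move=> P0 Q0; elim: n => [//|n IH]; exact: nonneg_conv. Qed.

Lemma conv_seq_nd P Q n t : (forall i, nonneg (Q i)) ->
  (lawcdf (conv_seq P Q n.+1) t <= lawcdf (conv_seq P Q n) t)%E.
Proof. by move=> Q0; exact: lawcdf_conv_nonneg. Qed.

(** X and Xc are the two coordinates on the product of P and Pc. *)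
Lemma self_decomposable_of_conv (P : PR) :
  (forall c : R, 0 < c < 1 -> exists Pc : PR, eqlaw (conv Pc (scale c P)) P) ->
  self_decomposable P.
Proof.
move=> H c c01; have [Pc PcE] := H c c01.
exists _, (T * T)%type, (product_probability P Pc).
have mX : measurable_fun setT (fst : T * T -> T) by exact: measurable_fst.
have mY : measurable_fun setT (snd : T * T -> T) by exact: measurable_snd.
exists (mfun_Sub (mem_set mX)), (mfun_Sub (mem_set mY)).
have XE A : measurable A -> product_probability P Pc (fst @^-1` A) = P A.
  move=> mA; rewrite -[fst @^-1` A]setIT.
  rewrite (_ : _ `&` _ = A `*` setT); last by apply/seteqP; split => -[].
  apply: (eq_trans (product_measure1E P Pc mA measurableT)).
  by rewrite [X in (_ * X)%E](probability_setT Pc) mule1.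
have YE A : measurable A -> product_probability P Pc (snd @^-1` A) = Pc A.
  move=> mA; rewrite -[snd @^-1` A]setIT.
  rewrite (_ : _ `&` _ = setT `*` A); last by apply/seteqP; split => -[] /= ? ? [].
  apply: (eq_trans (product_measure1E P Pc measurableT mA)).
  by rewrite [X in (X * _)%E](probability_setT P) mul1e.
split => //.
- move=> A B mA mB; rewrite /= XE// YE//.
  rewrite (_ : _ `&` _ = A `*` B); last by apply/seteqP; split => -[].
  exact: (product_measure1E P Pc mA mB).
- have mf : measurable_fun setT (fun w : T * T => (w.2 + c * w.1 : T)).
    apply: measurable_funD; first exact: measurable_snd.
    by apply: measurable_funM => //; exact: measurable_fst.
  suff E : eqlaw (image_prob (product_probability P Pc) mf) (conv (scale c P) Pc).
    move=> A mA; rewrite -[RHS]PcE// -[RHS](convC (scale c P) Pc)//.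
    exact: E.
  apply: integral_eqlaw => g mg g0.
  rewrite (integral_conv mg g0).
  rewrite (integral_scale (measurable_int_gadd mg g0 Pc)); last first.
    by move=> x; exact: integral_ge0.
  rewrite integral_image_prob//.
  have mgf : measurable_fun setT (fun w : T * T => g (w.2 + c * w.1)).
    exact: measurableT_comp.
  rewrite (@fubini_tonelli1 _ _ _ _ _ P Pc _ mgf (fun w => g0 _)).
  by apply: eq_integral => x _; apply: eq_integral => y _; rewrite /= addrC.
Qed.

End infinite_convolution.

Section exponential_series.
Variables (R : realType) (alpha : R) (l : nat -> R) (C : R).
Local Notation T := (measurableTypeR R).
Local Notation PR := (probability T R).
Hypothesis alpha0 : 0 <= alpha.
Hypothesis l0 : forall i, 0 <= l i.
Hypothesis lC : forall n, \sum_(i < n) l i <= C.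

Definition exp_sum : nat -> PR :=
  conv_seq (dirac_law alpha) (fun i => scale (l i) (exp_law R)).

(** The law of X_c for the n-th partial sum: the drift splits as (1 - c) alpha + c alpha, and each
    exponential into its thinned part plus c times a copy. *)
Definition thinned_sum (c : R) : nat -> PR :=
  conv_seq (dirac_law ((1 - c) * alpha)) (fun i => thinned_law (- ln (1 - c)) (l i)).

Let nonneg_exp i : nonneg (scale (l i) (exp_law R)).
Proof.
apply: nonneg_image; first exact: exp_law_nonneg.
by move=> u u0; rewrite mulr_ge0.
Qed.

Let nonneg_thinned c i : nonneg (thinned_law (- ln (1 - c)) (l i)).
Proof.
apply: nonneg_image; first exact: exp_law_nonneg.
by move=> u _; rewrite mulr_ge0// le_max lexx orbT.
Qed.

Lemma nonneg_exp_sum n : nonneg (exp_sum n).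
Proof. by apply: nonneg_conv_seq => //; exact: nonneg_dirac. Qed.

Lemma nonneg_thinned_sum c n : 0 < c < 1 -> nonneg (thinned_sum c n).
Proof.
move=> /andP[c0 c1]; apply: nonneg_conv_seq => //; apply: nonneg_dirac.
by rewrite mulr_ge0// subr_ge0 ltW.
Qed.

Lemma thinned_exp_sum c n : 0 < c < 1 ->
  eqlaw (conv (thinned_sum c n) (scale c (exp_sum n))) (exp_sum n).
Proof.
move=> c01; elim: n => [|n IH] /=.
  apply: eqlaw_trans (conv_eqlaw (@eqlaw_refl _ _) (scale_dirac _ _)) _.
  apply: eqlaw_trans (conv_dirac _ _) _.
  by rewrite (_ : _ + _ = alpha)//; ring.
apply: eqlaw_trans (conv_eqlaw (@eqlaw_refl _ _) (scale_conv _ _ _)) _.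
apply: eqlaw_trans (conv_interchange _ _ _ _) _.
by apply: conv_eqlaw => //; exact: thinned_conv.
Qed.

Lemma elaplace_exp_sum n x : 0 <= x ->
  elaplace (exp_sum n) x = (expR (- (alpha * x)) / \prod_(i < n) (1 + l i * x))%:E.
Proof.
move=> x0; elim: n => [|n IH] /=.
  by rewrite elaplace_dirac big_ord0 divr1 mulrC.
rewrite elaplace_conv IH elaplace_scale_exp// -EFinM big_ord_recr/=.
by rewrite invfM mulrA.
Qed.

Lemma exp_sum_tight (e : R) : 0 < e ->
  exists t, forall n, ((1 - e)%:E <= lawcdf (exp_sum n) t)%E.
Proof.
move=> e0; pose K := alpha + C + 1.
have C0 : 0 <= C by apply: le_trans (lC 0); rewrite big_ord0.
have K0 : 0 < K by rewrite ltr_wpDl // addr_ge0.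
pose x := e / 2 / K; have x0 : 0 < x by rewrite !divr_gt0.
have KX : K * x = e / 2 by rewrite /x mulrC mulfVK// gt_eqF.
exists (2 / e / x) => n.
have := elaplace_tail (2 / e / x) (nonneg_exp_sum n) x0.
rewrite elaplace_exp_sum ?(ltW x0)// => h.
have b1 : 1 - e / 2 <= expR (- (alpha * x)) / \prod_(i < n) (1 + l i * x).
  apply: (@le_trans _ _ (expR (- (K * x)))).
    by rewrite KX; apply: le_trans (expR_ge1Dx _).
  have p0 : 0 < \prod_(i < n) (1 + l i * x).
    by apply: prodr_gt0 => i _; rewrite ltr_wpDr// mulr_ge0// ltW.
  rewrite ler_pdivlMr//.
  apply: (@le_trans _ _ (expR (- (K * x)) * expR (C * x))).
    rewrite ler_wpM2l ?expR_ge0// (le_trans (prodr1D_le_expR _ _))//.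
      by move=> i; rewrite mulr_ge0// ltW.
    by rewrite ler_expR -mulr_suml ler_wpM2r// ltW.
  by rewrite -expRD ler_expR -subr_ge0 (_ : _ - _ = x) ?ltW// /K; ring.
have b2 : expR (- (x * (2 / e / x))) <= e / 2.
  have -> : x * (2 / e / x) = 2 / e by field; rewrite !gt_eqF.
  rewrite expRN -[leRHS]invrK invf_div lef_pV2 ?posrE ?expR_gt0 ?divr_gt0//.
  by apply: le_trans (expR_ge1Dx _); rewrite lerDr.
have fE := fineK (lawcdf_fin_num (exp_sum n) (2 / e / x)).
move: h; rewrite -fE -EFinD !lee_fin => h; lra.
Qed.

Lemma exp_series_law : exists nu : PR, [/\ nonneg nu, self_decomposable nu &
  forall x, 0 < x ->
    expR (- (alpha * x)) / \prod_(i < n) (1 + l i * x) @[n --> \oo] --> laplace nu x].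
Proof.
have nd n s : (lawcdf (exp_sum n.+1) s <= lawcdf (exp_sum n) s)%E by exact: conv_seq_nd.
have [nu cnu] := cdf_limit_exists nd nonneg_exp_sum exp_sum_tight.
have nu0 : nonneg nu := nonneg_lim nonneg_exp_sum cnu.
exists nu; split => //.
- apply: self_decomposable_of_conv => c c01; have /andP[c0 c1] := c01.
  have ndk n s : (lawcdf (thinned_sum c n.+1) s <= lawcdf (thinned_sum c n) s)%E.
    exact: conv_seq_nd.
  have nns n : nonneg (scale c (exp_sum n)).
    apply: nonneg_image; first exact: nonneg_exp_sum.
    by move=> u u0; rewrite mulr_ge0// ltW.
  (* Convolving with the law of c X only lowers the distribution function, so tightness of the full
     sums passes to the thinned ones. *)
  have tightk e : 0 < e -> exists t, forall n, ((1 - e)%:E <= lawcdf (thinned_sum c n) t)%E.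
    move=> e0; have [t Ht] := exp_sum_tight e0; exists t => n.
    apply: (le_trans (Ht n)); rewrite -[leLHS](thinned_exp_sum n c01)//.
    exact: lawcdf_conv_nonneg.
  have [nuc cnuc] := cdf_limit_exists ndk (fun n => nonneg_thinned_sum n c01) tightk.
  exists nuc; apply: (conv_cdf_limit ndk _ (fun n => thinned_exp_sum n c01) cnuc _ cnu).
  + by move=> n s; rewrite !lawcdf_scale.
  + move=> s; rewrite lawcdf_scale//; under eq_cvg do rewrite lawcdf_scale//.
    exact: cnu.
- move=> x x0; rewrite laplaceE//.
  have := cvg_elaplace nonneg_exp_sum cnu x0.
  under eq_cvg do rewrite elaplace_exp_sum ?(ltW x0)//.
  by rewrite -[elaplace nu x]fineK ?elaplace_fin_num//; exact: fine_cvg.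
Qed.
End exponential_series.

(** * The Thorin measure *)

Section ggc.
Variables (R : realType) (alpha : R) (l : nat -> R) (C : R).
Local Notation T := (measurableTypeR R).
Local Notation PR := (probability T R).
Hypothesis alpha0 : 0 <= alpha.
Hypothesis l0 : forall i, 0 <= l i.
Hypothesis lC : forall n, \sum_(i < n) l i <= C.

(* A factor with [l i = 0] contributes a mass at [0^-1 = 0], outside ]0, +oo[. *)
Definition thorin_measure : {measure set T -> \bar R} :=
  mseries (fun i => @dirac _ T (l i)^-1 R) 0.

(** At t = 1 / l, ln(t / (s + t)) = - ln(1 + l s). The sign is pulled out first because integration
    against a series of measures is applied to nonnegative functions. *)
Lemma integral_thorin_measure (s : R) : 0 <= s ->
  (\int[thorin_measure]_(t in `]0%R, +oo[) (ln (t / (s + t)))%:E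
   = - (\sum_(0 <= i <oo) (ln (1 + l i * s))%:E))%E.
Proof.
move=> s0; pose f (t : T) : R := ln (s + t) - ln t.
have mf : measurable_fun setT f.
  apply: measurable_funB; last exact: measurable_ln.
  by apply: measurableT_comp; [exact: measurable_ln|exact: measurable_funD].
have f0 (t : T) : `]0, +oo[%classic t -> (0 <= (f t)%:E)%E.
  rewrite /= in_itv/= andbT lee_fin subr_ge0 => t0.
  by rewrite ler_ln ?posrE ?ltr_wpDl// lerDr.
transitivity (\int[thorin_measure]_(t in `]0%R, +oo[) - (f t)%:E)%E.
  apply: eq_integral => t; rewrite inE/= in_itv/= andbT => t0.
  by rewrite ln_div ?posrE ?ltr_wpDl// -[RHS]/((- f t)%:E) opprB.
rewrite integral_ge0N//; congr (- _)%E.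
rewrite ge0_integral_measure_series//; last first.
  by apply/measurable_EFinP; exact: measurable_funTS.
apply: eq_eseriesr => i _.
rewrite integral_dirac//; last by apply/measurable_EFinP; exact: measurable_funTS.
have [li0|li0] := eqVneq (l i) 0.
  by rewrite li0 mul0r addr0 ln1 invr0 diracE memNset ?mul0e//= in_itv/= ltxx.
have lp : 0 < l i by rewrite lt_neqAle eq_sym li0 l0.
rewrite diracE mem_set ?mul1e/=; last by rewrite in_itv/= invr_gt0 lp.
rewrite /f -ln_div ?posrE ?ltr_wpDl ?invr_gt0//.
by congr (ln _)%:E; rewrite invrK mulrDl mulVf// addrC mulrC.
Qed.

Lemma GGC_exp_series (nu : PR) : nonneg nu ->
  (forall x, 0 < x ->
    expR (- (alpha * x)) / \prod_(i < n) (1 + l i * x) @[n --> \oo] --> laplace nu x) ->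
  GGC nu.
Proof.
move=> nu0 Hnu; split; first exact: nonneg_on.
exists alpha, thorin_measure; split => // s s0; rewrite integral_thorin_measure//.
have ls i : 0 <= l i * s by rewrite mulr_ge0.
have ln0 i : 0 <= ln (1 + l i * s) by rewrite ln_ge0// lerDl.
pose S n := \sum_(i < n) ln (1 + l i * s).
have Snd : nondecreasing_seq S.
  by apply/nondecreasing_seqP => n; rewrite /S big_ord_recr/= lerDl.
have SC n : S n <= C * s.
  apply: (@le_trans _ _ (\sum_(i < n) l i * s)); last by rewrite -mulr_suml ler_wpM2r.
  by apply: ler_sum => i _; rewrite le_ln1Dx// (lt_le_trans (ltrN10 _)).
have cS : cvgn S by apply: nondecreasing_is_cvgn => //; exists (C * s) => _ [n _ <-].
have -> : (\sum_(0 <= i <oo) (ln (1 + l i * s))%:E)%E = (limn S)%:E.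
  apply/cvg_lim => //; apply: cvg_EFin; first by apply: nearW => n; rewrite sumEFin.
  rewrite (_ : _ \o _ = S)//; apply/funext => n.
  by rewrite /= sumEFin/= big_mkord.
rewrite -EFinN -EFinD /=; congr (_%:E); rewrite expRD.
have ES n : expR (- S n) = (\prod_(i < n) (1 + l i * s))^-1.
  rewrite expRN expR_sum; congr (_^-1); apply: eq_bigr => i _.
  by rewrite lnK// posrE ltr_pwDl.
(* At s = 0, outside the range of [Hnu], both sides are 1. *)
move: s0; rewrite le_eqVlt => /orP[/eqP s0|s0].
  have S0 n : S n = 0.
    by rewrite /S big1// => i _; rewrite -s0 mulr0 addr0 ln1.
  rewrite (_ : S = fun=> 0); last exact/funext.
  rewrite lim_cst// -s0 mulr0 oppr0 expR0 mulr1 laplaceE// /elaplace.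
  under eq_integral do rewrite mul0r oppr0 expR0.
  by rewrite integral_cst// [X in fine (_ * X)%E](probability_setT nu) mule1.
have h : expR (- (alpha * s)) / \prod_(i < n) (1 + l i * s) @[n --> \oo]
    --> expR (- (alpha * s)) * expR (- limn S).
  apply: cvgM; first exact: cvg_cst.
  under eq_cvg do rewrite -ES.
  by apply: continuous_cvg; [exact: continuous_expR|exact: cvgN].
exact: (cvg_unique _ (Hnu s s0) h).
Qed.

End ggc.

Lemma hyp0F1_ge1 (R : realType) (b z : R) : 0 < b -> 0 <= z -> 1 <= hyp0F1 b z.
Proof.
move=> b0 z0; apply: le_trans (series_hyp0F1_le 1 b0 z0).
by rewrite seriesEord/= big_ord1 /hyp0F1_coeff /pochhammer big_ord0 fact0 expr0 mulr1 divr1.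
Qed.

Unset Implicit Arguments.

Theorem theorem7 (R : realType) (mu a : R) (hmu : -1 < mu) (ha : 0 < a) :
  (exists nu : probability (measurableTypeR R) R,
     GGC nu /\ forall x : R, 0 < x -> laplace nu x = rho mu a x) /\
  (exists nu : probability (measurableTypeR R) R,
     [/\ on_nonneg nu, self_decomposable nu
       & forall x : R, 0 < x -> laplace nu x = rho mu a x]).
Proof.
have b0 : 0 < mu + 1 by rewrite -ltrBlDr sub0r.
have [alpha [lam [alpha0 lam0 [C lamC] lamF]]] := hyp0F1_factor b0.
pose k := a ^+ 2 / 4; have k0 : 0 < k by rewrite divr_gt0// exprn_gt0.
have al0 : 0 <= alpha * k by rewrite mulr_ge0// ltW.
have l0 i : 0 <= lam i * k by rewrite mulr_ge0// ltW.
have lC n : \sum_(i < n) lam i * k <= C * k.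
  by rewrite -mulr_suml ler_wpM2r// ltW.
have [nu [nu0 nusd nuL]] := exp_series_law al0 l0 lC.
have nurho x : 0 < x -> laplace nu x = rho mu a x.
  move=> x0; rewrite rhoE//; set z := a ^+ 2 / 4 * x.
  have z0 : 0 < z by rewrite mulr_gt0.
  have F0 : hyp0F1 (mu + 1) z != 0.
    by rewrite gt_eqF// (lt_le_trans ltr01)// hyp0F1_ge1// ltW.
  (* The drift of the law cancels the exponential left over in the product formula, so only 1 / F
     remains. *)
  have h : expR (- (alpha * k * x)) / \prod_(i < n) (1 + lam i * k * x) @[n --> \oo]
      --> expR (- (alpha * z)) / (hyp0F1 (mu + 1) z * expR (- (alpha * z))).
    rewrite -[alpha * k * x]mulrA; apply: cvgM; first exact: cvg_cst.
    apply: cvgV; first by rewrite mulf_neq0// gt_eqF// expR_gt0.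
    under eq_cvg do under eq_bigr do rewrite -mulrA.
    exact: lamF (ltW z0).
  have -> : laplace nu x = expR (- (alpha * z)) / (hyp0F1 (mu + 1) z * expR (- (alpha * z))).
    exact: (cvg_unique _ (nuL x x0) h).
  by rewrite invfM mulrCA divff ?mulr1// gt_eqF// expR_gt0.
split; exists nu; split => //; first exact: (GGC_exp_series al0 l0 lC).
exact: nonneg_on.
Qed.
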